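(* Let $\mathcal{A}$ be a unital associative complex algebra. For any differential calculus $\Omega$ over $\mathcal{A}$ for $\mathbf{Alg}_Z$, there is a unique homomorphism of graded differential algebras $j_\Omega:\Omega_Z(\mathcal{A})\to\Omega$ which induces the identity mapping of $\mathcal{A}$ onto itself.
   Context: A graded differential algebra is a unital associative complex $\mathbb{Z}$-graded algebra with a linear map $d$ of degree $1$ satisfying $d(xy)=d(x)y+(-1)^m x\,d(y)$ for $x$ of degree $m$, and $d^2=0$. Homomorphisms of graded differential algebras are unital algebra homomorphisms of degree $0$ commuting with the differentials. $Z(\mathcal{A})$ is the center of $\mathcal{A}$. An $(\mathcal{A},\mathcal{A})$-bimodule $\mathcal{M}$ is central if $zm=mz$ for all $z\in Z(\mathcal{A})$, $m\in\mathcal{M}$. A differential calculus over $\mathcal{A}$ for $\mathbf{Alg}_Z$ is an $\mathbb{N}$-graded differential algebra $\Omega=\bigoplus_{n\ge0}\Omega^n$ with $\Omega^0=\mathcal{A}$ such that each $\Omega^n$ is a central bimodule over $\mathcal{A}$. Let $\Omega^1_u(\mathcal{A})\subset\mathcal{A}\otimes_{\mathbb{C}}\mathcal{A}$ be the kernel of the product map $x\otimes y\mapsto xy$, an $(\mathcal{A},\mathcal{A})$-bimodule, with derivation $d_u(x)=1\otimes x-x\otimes1$. Let $\Omega_u(\mathcal{A})=\bigoplus_{n\ge0}\Omega^n_u(\mathcal{A})$ be the tensor algebra over $\mathcal{A}$ of this bimodule ($\Omega^0_u(\mathcal{A})=\mathcal{A}$ and $\Omega^n_u(\mathcal{A})$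 is the $n$-fold tensor power of $\Omega^1_u(\mathcal{A})$ over $\mathcal{A}$); $d_u$ extends uniquely to a differential on $\Omega_u(\mathcal{A})$, making it a graded differential algebra. Let $[Z(\mathcal{A}),\Omega^1_u(\mathcal{A})]\subset\Omega^1_u(\mathcal{A})$ be the subbimodule spanned by the elements $z\omega-\omega z$ ($z\in Z(\mathcal{A})$, $\omega\in\Omega^1_u(\mathcal{A})$), and let $I_Z$ be the two-sided ideal of $\Omega_u(\mathcal{A})$ generated by $[Z(\mathcal{A}),\Omega^1_u(\mathcal{A})]$ and $d_u([Z(\mathcal{A}),\Omega^1_u(\mathcal{A})])$. Then $I_Z$ is graded and stable under $d_u$, and $\Omega_Z(\mathcal{A})=\Omega_u(\mathcal{A})/I_Z$ is a graded differential algebra with $\Omega^0_Z(\mathcal{A})=\mathcal{A}$; it is a differential calculus over $\mathcal{A}$ for $\mathbf{Alg}_Z$. *)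

(* Defs.v *)
From HB Require Import structures.
From mathcomp Require Import all_boot all_order all_algebra.
From mathcomp Require Import boolp.

Set Implicit Arguments.
Unset Strict Implicit.
Unset Printing Implicit Defensive.

Import Order.TTheory GRing.Theory Num.Theory.
Local Open Scope ring_scope.
Local Open Scope quotient_scope.

Section AdditiveMaps.
Context (U V : zmodType) (f : U -> V) (fD : {morph f : x y / x + y}).

Lemma morphD0 : f 0 = 0.
Proof. by apply: (addIr (f 0)); rewrite -fD !add0r. Qed.

Lemma morphDN x : f (- x) = - f x.
Proof. by apply: (addIr (f x)); rewrite -fD !addNr morphD0. Qed.

Lemma morphDB x y : f (x - y) = f x - f y.
Proof. by rewrite fD morphDN. Qed.

Lemma morphD_sum I (r : seq I) (P : pred I) (F : I -> U) :
  f (\sum_(i <- r | P i) F i) = \sum_(i <- r | P i) f (F i).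
Proof. exact: (big_morph f fD morphD0). Qed.

End AdditiveMaps.

Section GradedDifferentialAlgebras.
Context (K : fieldType).

(* G n is the set of homogeneous elements of degree n, and the algebra is the
   internal direct sum of the subspaces G n. *)
Record is_grading (T : algType K) (G : int -> T -> Prop) : Prop := {
  gr_zero : forall n, G n 0;
  gr_add : forall n x y, G n x -> G n y -> G n (x + y);
  gr_scale : forall n k x, G n x -> G n (k *: x);
  gr_one : G 0 1;
  gr_mul : forall m n x y, G m x -> G n y -> G (m + n) (x * y);
  gr_span : forall x, exists (s : seq int) (c : int -> T),
    (forall n, G n (c n)) /\ x = \sum_(n <- s) c n;
  gr_free : forall (s : seq int) (c : int -> T), uniq s ->
    (forall n, G n (c n)) -> \sum_(n <- s) c n = 0 ->
    forall n, n \in s -> c n = 0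
}.

(* In the Leibniz rule the sign (-1)^m, for m : int, only depends on `|m|. *)
Record is_differential (T : algType K) (G : int -> T -> Prop)
    (d : T -> T) : Prop := {
  diff_linear : linear d;
  diff_degree : forall n x, G n x -> G (n + 1) (d x);
  diff_leibniz : forall m x y, G m x ->
    d (x * y) = d x * y + (-1) ^+ `|m|%N * (x * d y);
  diff_square : forall x, d (d x) = 0
}.

Record gda := Gda {
  gda_sort :> algType K;
  gr : int -> gda_sort -> Prop;
  diff : gda_sort -> gda_sort;
  grP : is_grading gr;
  diffP : is_differential gr diff
}.

Record gda_hom (Om Om' : gda) (f : Om -> Om') : Prop := {
  gda_hom_linear : linear f;
  gda_hom_monoid : monoid_morphism f;
  gda_hom_degree : forall n x, gr n x -> gr n (f x);
  gda_hom_diff : forall x, f (diff x) = diff (f x)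
}.

Definition in_center (A : pzRingType) (z : A) := forall a, z * a = a * z.

(* Differential calculi over A for Alg_Z. The identification of A with the
   subalgebra of elements of degree 0 is the map calc_inj. *)
Record calculus (A : algType K) := Calculus {
  calc_gda :> gda;
  calc_inj : A -> calc_gda;
  calc_inj_linear : linear calc_inj;
  calc_inj_monoid : monoid_morphism calc_inj;
  calc_inj_inj : injective calc_inj;
  calc_deg0 : forall x : calc_gda, gr 0 x <-> exists a, x = calc_inj a;
  calc_nneg : forall (n : int) (x : calc_gda), n < 0 -> gr n x -> x = 0;
  calc_central : forall (n : int) (z : A) (x : calc_gda), in_center z -> gr n x ->
    calc_inj z * x = x * calc_inj z
}.

(* A grading by natural numbers, given by its projections c n, seen as a
   grading by integers. *)
Lemma nat_grading (T : algType K) (G : int -> T -> Prop) (c : nat -> T -> T) :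
  (forall n, {morph c n : x y / x + y}) ->
  (forall n (k : K) x, c n (k *: x) = k *: c n x) ->
  (forall m n x, m != n -> c m (c n x) = 0) ->
  (forall x, exists N, x = \sum_(i < N) c i x) ->
  c 0%N 1 = 1 ->
  (forall m n x y, c m x = x -> c n y = y -> c (m + n)%N (x * y) = x * y) ->
  (forall n x, c n (c n x) = c n x) ->
  (forall n x, G (Posz n) x <-> c n x = x) ->
  (forall n x, G (Negz n) x <-> x = 0) -> is_grading G.
Proof.
move=> cD cZ cO cS c1 cM cI GP GN.
have G0 n : G n 0.
  by case: n => n; [apply/GP/(morphD0 (cD n)) | apply/GN].
have comp m (n : int) x : n != Posz m -> G n x -> c m x = 0.
  case: n => n nm; last by move/GN->; apply: (morphD0 (cD m)).
  by move/GP <-; apply: cO; apply: contraNneq nm => ->.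
split=> //.
- case=> n x y; first by move=> /GP xn /GP yn; apply/GP; rewrite cD xn yn.
  by move=> /GN -> /GN ->; apply/GN; rewrite addr0.
- case=> n k x; first by move=> /GP xn; apply/GP; rewrite cZ xn.
  by move=> /GN ->; apply/GN; rewrite scaler0.
- exact/GP.
- move=> [m|m] n x y; last by move=> /GN ->; rewrite mul0r.
  case: n => n; last by move=> _ /GN ->; rewrite mulr0.
  by move=> /GP xm /GP yn; rewrite -PoszD; apply/GP/cM.
- move=> x; have [N xN] := cS x; exists [seq Posz i | i <- iota 0 N].
  exists (fun n => if n is Posz m then c m x else 0); split.
    by case=> n; [apply/GP | apply/GN].
  by rewrite big_map -[N in iota 0 N]subn0 big_mkord.
- move=> s f us Gf f0 [m|m] ms; last by apply/GN.
  have fm : c m (f m) = f m by apply/GP.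
  have := morphD0 (cD m); rewrite -f0 (morphD_sum (cD m)) (bigD1_seq (Posz m)) //=.
  by rewrite fm big1 ?addr0 // => n nm; apply: (comp _ n).
Qed.

End GradedDifferentialAlgebras.

(* The tensor product of a right S-module M and a left S-module N: formal sums
   of pure tensors (lists of pairs) modulo the congruence generated by
   biadditivity and balancedness. Its opposite negates the left factors. *)
Section Tensor.
Context (S : Type) (M N : zmodType) (r : M -> S -> M) (l : S -> N -> N).

Inductive tensor_eq : seq (M * N) -> seq (M * N) -> Prop :=
| teq_refl s : tensor_eq s s
| teq_sym s t : tensor_eq s t -> tensor_eq t s
| teq_trans s t u : tensor_eq s t -> tensor_eq t u -> tensor_eq s u
| teq_cat s s' t t' :
    tensor_eq s s' -> tensor_eq t t' -> tensor_eq (s ++ t) (s' ++ t')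
| teq_catC s t : tensor_eq (s ++ t) (t ++ s)
| teq_0 y : tensor_eq [:: (0, y)] [::]
| teq_Dl x x' y : tensor_eq [:: (x + x', y)] [:: (x, y); (x', y)]
| teq_Dr x y y' : tensor_eq [:: (x, y + y')] [:: (x, y); (x, y')]
| teq_bal x c y : tensor_eq [:: (r x c, y)] [:: (x, l c y)].

Definition teqb : rel (seq (M * N)) := fun s t => `[< tensor_eq s t >].

Lemma teqb_equiv : equiv_class_of teqb.
Proof.
split=> [s|s t|t s u]; first exact/asboolP/teq_refl.
- by apply/asboolP/asboolP; apply: teq_sym.
- by move=> /asboolP st /asboolP tu; apply/asboolP; apply: teq_trans st tu.
Qed.
Canonical teqb_equiv_rel := EquivRelPack teqb_equiv.

Definition tensor := {eq_quot teqb}.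
HB.instance Definition _ : EqQuotient _ teqb tensor := EqQuotient.on tensor.
HB.instance Definition _ := Choice.on tensor.

Local Notation cls := (\pi_tensor).

Lemma clsP s t : cls s = cls t <-> tensor_eq s t.
Proof. by split=> [/eqquotP /asboolP|st] //; apply/eqquotP/asboolP. Qed.

Definition tsum (V : zmodType) (f : M -> N -> V) (s : seq (M * N)) : V :=
  \sum_(p <- s) f p.1 p.2.

Definition tneg (s : seq (M * N)) := [seq (- p.1, p.2) | p <- s].

Definition tadd (u v : tensor) : tensor := cls (repr u ++ repr v).
Definition topp (u : tensor) : tensor := cls (tneg (repr u)).
Definition tzero : tensor := cls [::].

Lemma teq_repr s : tensor_eq (repr (cls s)) s.
Proof. by apply/clsP; rewrite reprK. Qed.

Lemma taddE s t : tadd (cls s) (cls t) = cls (s ++ t).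
Proof. by apply/clsP; apply: teq_cat; apply: teq_repr. Qed.

Lemma tneg_cancel s : tensor_eq (tneg s ++ s) [::].
Proof.
elim: s => [|[x y] s IHs]; first exact: teq_refl.
have -> : tneg ((x, y) :: s) ++ (x, y) :: s
  = [:: (- x, y)] ++ ((tneg s ++ [:: (x, y)]) ++ s) by rewrite /= -catA.
apply: (@teq_trans _ ([:: (- x, y)] ++ (([:: (x, y)] ++ tneg s) ++ s))).
  by do 2![apply: teq_cat; try exact: teq_refl]; apply: teq_catC.
apply: (@teq_cat [:: (- x, y); (x, y)] [::] _ [::]) => //.
apply: teq_trans (teq_0 y); rewrite -(addNr x).
by apply: teq_sym; apply: teq_Dl.
Qed.

Lemma clsS u : exists s, u = cls s.
Proof. by exists (repr u); rewrite reprK. Qed.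

Lemma taddA : associative tadd.
Proof.
move=> u v w; have [s ->] := clsS u; have [t ->] := clsS v; have [q ->] := clsS w.
by rewrite (taddE s t) (taddE t q) (taddE s) (taddE (s ++ t)) catA.
Qed.

Lemma taddC : commutative tadd.
Proof.
move=> u v; have [s ->] := clsS u; have [t ->] := clsS v.
by rewrite (taddE s t) (taddE t s); apply/clsP; apply: teq_catC.
Qed.

Lemma tadd0 : left_id tzero tadd.
Proof. by move=> u; have [s ->] := clsS u; rewrite (taddE [::] s). Qed.

Lemma taddN : left_inverse tzero topp tadd.
Proof.
move=> u; rewrite -{2}[u]reprK (taddE (tneg (repr u))).
by apply/clsP; apply: tneg_cancel.
Qed.

HB.instance Definition _ := GRing.isZmodule.Build tensor taddA taddC tadd0 taddN.

Definition pure (x : M) (y : N) : tensor := cls [:: (x, y)].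

Lemma pureDl x x' y : pure (x + x') y = pure x y + pure x' y.
Proof. by rewrite [RHS](taddE [:: _] [:: _]); apply/clsP; apply: teq_Dl. Qed.

Lemma pureDr x y y' : pure x (y + y') = pure x y + pure x y'.
Proof. by rewrite [RHS](taddE [:: _] [:: _]); apply/clsP; apply: teq_Dr. Qed.

Lemma pure_bal x c y : pure (r x c) y = pure x (l c y).
Proof. by apply/clsP; apply: teq_bal. Qed.

Lemma tensor_ind (P : tensor -> Prop) :
  P 0 -> (forall u v, P u -> P v -> P (u + v)) ->
  (forall x y, P (pure x y)) -> forall u, P u.
Proof.
move=> P0 PD P1 u; rewrite -[u]reprK; elim: (repr u) => [//|[x y] s IHs].
rewrite -cat1s -(taddE [:: _] s); apply: PD => //; exact: P1.
Qed.

Record balanced (V : zmodType) (f : M -> N -> V) : Prop := {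
  balDl : forall x x' y, f (x + x') y = f x y + f x' y;
  balDr : forall x y y', f x (y + y') = f x y + f x y';
  balM : forall x c y, f (r x c) y = f x (l c y)
}.

(* Only meaningful if f is balanced: see tliftE and tliftD. *)
Definition tlift (V : zmodType) (f : M -> N -> V) (u : tensor) : V :=
  tsum f (repr u).

Section Lift.
Context (V : zmodType) (f : M -> N -> V) (fbal : balanced f).

Lemma tsum_eq s t : tensor_eq s t -> tsum f s = tsum f t.
Proof.
rewrite /tsum; elim=> {s t} //=.
- by move=> s t u _ -> _ ->.
- by move=> s s' t t' _ IHs _ IHt; rewrite !big_cat /= IHs IHt.
- by move=> s t; rewrite !big_cat /= addrC.
- move=> y; rewrite big_seq1 big_nil /=.
  by apply: (morphD0 (f := f^~ y)) => x x'; apply: balDl.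
- by move=> x x' y; rewrite !big_cons !big_nil /= !addr0 balDl.
- by move=> x y y'; rewrite !big_cons !big_nil /= !addr0 balDr.
- by move=> x c y; rewrite !big_seq1 /= balM.
Qed.

Lemma tliftE x y : tlift f (pure x y) = f x y.
Proof. by rewrite /tlift (tsum_eq (teq_repr _)) /tsum big_seq1. Qed.

Lemma tliftD : {morph tlift f : u v / u + v}.
Proof.
by move=> u v; rewrite /tlift (tsum_eq (teq_repr _)) /tsum big_cat.
Qed.

End Lift.
End Tensor.

Arguments pure {S M N r l}.

Section DirectSum.
Context (V : nat -> zmodType).

Definition finitely_supported (f : forall n, V n) :=
  exists N, forall n, (N <= n)%N -> f n = 0.

Record dsum := DSum {
  dsum_fun :> forall n, V n;
  dsum_finite : `[< finitely_supported dsum_fun >]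
}.
HB.instance Definition _ := [isSub for dsum_fun].
HB.instance Definition _ := gen_eqMixin dsum.
HB.instance Definition _ := gen_choiceMixin dsum.

Lemma dsumP (s t : dsum) : (forall n, s n = t n) -> s = t.
Proof. by move=> st; apply/val_inj/functional_extensionality_dep. Qed.

Lemma dsum_supp (t : dsum) : finitely_supported t.
Proof. exact/asboolP/(dsum_finite t). Qed.

Lemma dsum_zero_finite : `[< finitely_supported (fun=> 0) >].
Proof. by apply/asboolP; exists 0. Qed.

Lemma dsum_opp_finite (t : dsum) : `[< finitely_supported (fun n => - t n) >].
Proof.
by apply/asboolP; have [N tN] := dsum_supp t; exists N => n /tN ->; rewrite oppr0.
Qed.

Lemma dsum_add_finite (s t : dsum) :
  `[< finitely_supported (fun n => s n + t n) >].
Proof.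
apply/asboolP; have [M sM] := dsum_supp s; have [N tN] := dsum_supp t.
by exists (maxn M N) => n; rewrite geq_max => /andP[/sM -> /tN ->]; rewrite addr0.
Qed.

Definition dsum_zero := DSum dsum_zero_finite.
Definition dsum_opp t := DSum (dsum_opp_finite t).
Definition dsum_add s t := DSum (dsum_add_finite s t).

Lemma dsum_addA : associative dsum_add.
Proof. by move=> s t u; apply: dsumP => n; apply: addrA. Qed.
Lemma dsum_addC : commutative dsum_add.
Proof. by move=> s t; apply: dsumP => n; apply: addrC. Qed.
Lemma dsum_add0 : left_id dsum_zero dsum_add.
Proof. by move=> s; apply: dsumP => n; apply: add0r. Qed.
Lemma dsum_addN : left_inverse dsum_zero dsum_opp dsum_add.
Proof. by move=> s; apply: dsumP => n; apply: addNr. Qed.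

HB.instance Definition _ :=
  GRing.isZmodule.Build dsum dsum_addA dsum_addC dsum_add0 dsum_addN.

Lemma dsumD (s t : dsum) n : (s + t) n = s n + t n. Proof. by []. Qed.
Lemma dsum0 n : (0 : dsum) n = 0. Proof. by []. Qed.

Lemma dsum_sumE I (r : seq I) (P : pred I) (F : I -> dsum) n :
  (\sum_(i <- r | P i) F i) n = \sum_(i <- r | P i) F i n.
Proof. exact: (morphD_sum (f := fun t : dsum => t n)). Qed.

Lemma dinj_finite n (x : V n) :
  `[< finitely_supported (@dfwith _ (fun n => V n) (fun=> 0) n x) >].
Proof.
apply/asboolP; exists n.+1 => i ni; rewrite dfwith_out //.
by apply: contraTneq ni => ->; rewrite ltnn.
Qed.

Definition dinj n (x : V n) : dsum := DSum (dinj_finite x).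

Lemma dinjE n (x : V n) : dinj x n = x.
Proof. exact: dfwith_in. Qed.

Lemma dinj_out n (x : V n) i : i != n -> dinj x i = 0.
Proof. by move=> ni; apply: dfwith_out; rewrite eq_sym. Qed.

Lemma dinjD n : {morph @dinj n : x y / x + y}.
Proof.
move=> x y; apply: dsumP => i; rewrite dsumD; have [->|ni] := eqVneq i n.
  by rewrite !dinjE.
by rewrite !dinj_out ?addr0.
Qed.

Lemma dsum_decomp (t : dsum) N :
  (forall n, (N <= n)%N -> t n = 0) -> t = \sum_(i < N) dinj (t i).
Proof.
move=> tN; apply: dsumP => n; rewrite dsum_sumE.
have [nN|Nn] := ltnP n N.
  rewrite (bigD1 (Ordinal nN)) // big1 => [|i ni].
    by rewrite Monoid.mulm1; apply/esym/dinjE.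
  by apply: dinj_out; rewrite eq_sym.
rewrite tN // big1 // => i _; apply: dinj_out.
by apply: contraTneq Nn => ->; rewrite -ltnNge.
Qed.

Lemma dsum_ind (P : dsum -> Prop) :
  P 0 -> (forall s t, P s -> P t -> P (s + t)) ->
  (forall n (x : V n), P (dinj x)) -> forall t, P t.
Proof.
move=> P0 PD P1 t; have [N /dsum_decomp ->] := dsum_supp t.
by elim/big_ind: _.
Qed.

Definition dbound (t : dsum) : nat := projT1 (cid (dsum_supp t)).

Lemma dboundP (t : dsum) n : (dbound t <= n)%N -> t n = 0.
Proof. by rewrite /dbound; case: cid => N /= tN /tN. Qed.

Definition dlift (W : zmodType) (f : forall n, V n -> W) (t : dsum) : W :=
  \sum_(i < dbound t) f i (t i).

Section Lift.
Context (W : zmodType) (f : forall n, V n -> W).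
Context (fD : forall n, {morph @f n : x y / x + y}).

Lemma dlift_bound (t : dsum) N :
  (forall n, (N <= n)%N -> t n = 0) -> dlift f t = \sum_(i < N) f (t i).
Proof.
move=> tN; pose F i := f (t i).
have tail a b : (forall n, (a <= n)%N -> t n = 0) -> (a <= b)%N ->
    \sum_(i < a) F i = \sum_(i < b) F i.
  move=> ta ab; rewrite -!(big_mkord xpredT F) [RHS](big_cat_nat (n := a)) //=.
  rewrite [X in _ = _ + X]big1_seq ?addr0 // => i /andP[_].
  by rewrite mem_index_iota => /andP[/ta ti _]; rewrite /F ti (morphD0 (@fD i)).
rewrite /dlift -/F (tail _ (maxn (dbound t) N)) ?leq_maxl //; last exact: dboundP.
by rewrite -(tail N) ?leq_maxr.
Qed.

Lemma dliftD : {morph dlift f : s t / s + t}.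
Proof.
move=> s t; pose N := maxn (dbound s) (dbound t).
have sN n : (N <= n)%N -> s n = 0.
  by rewrite geq_max => /andP[sn _]; apply: dboundP.
have tN n : (N <= n)%N -> t n = 0.
  by rewrite geq_max => /andP[_ tn]; apply: dboundP.
rewrite !(@dlift_bound _ N) // => [|n Nn]; last by rewrite dsumD sN ?tN ?addr0.
by rewrite -big_split; apply: eq_bigr => i _; apply: fD.
Qed.

Lemma dlift_inj n (x : V n) : dlift f (dinj x) = f x.
Proof.
have xN i : (n.+1 <= i)%N -> dinj x i = 0.
  by move=> ni; rewrite dinj_out //; apply: contraTneq ni => ->; rewrite ltnn.
rewrite (dlift_bound xN) big_ord_recr big1 => [|i _].
  by rewrite Monoid.mul1m; congr f; apply: dinjE.
have -> : dinj x (widen_ord (leqnSn n) i) = 0.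
  by apply: dinj_out; rewrite /= neq_ltn ltn_ord.
exact: (morphD0 (@fD i)).
Qed.

End Lift.
End DirectSum.

Section TensorAlgebra.
Context (K : fieldType) (A : algType K).

(* Bimodules over the K-algebra A: left A-modules with a commuting right action
   such that K acts in the same way on both sides. *)
Record bimodule := Bimodule {
  bimod_sort :> lmodType A;
  ract : bimod_sort -> A -> bimod_sort;
  ractDl : forall m m' a, ract (m + m') a = ract m a + ract m' a;
  ractDr : forall m a b, ract m (a + b) = ract m a + ract m b;
  ractM : forall m a b, ract m (a * b) = ract (ract m a) b;
  ract1 : forall m, ract m 1 = m;
  lractA : forall a m b, ract (a *: m) b = a *: ract m b;
  lractK : forall (k : K) m, k%:A *: m = ract m k%:A
}.

Section TensorLeft.
Context (M : bimodule) (N : lmodType A).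

Definition tensorA := tensor (@ract M) (@GRing.scale A N).
HB.instance Definition _ := GRing.Zmodule.on tensorA.

Definition tensorA_scale (a : A) : tensorA -> tensorA :=
  tlift (fun m n => pure (a *: m) n).

Lemma tensorA_scale_bal a : balanced (@ract M) (@GRing.scale A N)
  (fun m n => pure (a *: m) n : tensorA).
Proof.
split=> [x x' y|x y y'|x c y]; first by rewrite scalerDr; apply: pureDl.
- exact: pureDr.
- by rewrite -lractA; apply: pure_bal.
Qed.

Lemma tensorA_scaleE a m n :
  tensorA_scale a (pure m n) = pure (a *: m) n.
Proof. exact: (tliftE (tensorA_scale_bal a)). Qed.

Lemma tensorA_scaleDr : right_distributive tensorA_scale +%R.
Proof. by move=> a; apply: (tliftD (tensorA_scale_bal a)). Qed.

Lemma tensorA_scaleA a b v :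
  tensorA_scale a (tensorA_scale b v) = tensorA_scale (a * b) v.
Proof.
elim/tensor_ind: v => [|u v IHu IHv|m n].
- by rewrite !(morphD0 (tensorA_scaleDr _)).
- by rewrite !tensorA_scaleDr IHu IHv.
- by rewrite !tensorA_scaleE scalerA.
Qed.

Lemma tensorA_scale1 : left_id 1 tensorA_scale.
Proof.
elim/tensor_ind=> [|u v IHu IHv|m n].
- by rewrite (morphD0 (tensorA_scaleDr _)).
- by rewrite tensorA_scaleDr IHu IHv.
- by rewrite tensorA_scaleE scale1r.
Qed.

Lemma tensorA_scaleDl v : {morph tensorA_scale^~ v : a b / a + b}.
Proof.
move=> a b /=; elim/tensor_ind: v => [|u v IHu IHv|m n].
- by rewrite !(morphD0 (tensorA_scaleDr _)) addr0.
- by rewrite !tensorA_scaleDr IHu IHv addrACA.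
- by rewrite !tensorA_scaleE scalerDl; apply: pureDl.
Qed.

HB.instance Definition _ := GRing.Zmodule_isLmodule.Build A tensorA
  tensorA_scaleA tensorA_scale1 tensorA_scaleDr tensorA_scaleDl.

Definition tens (m : M) (n : N) : tensorA := pure m n.

Lemma tensDl m m' n : tens (m + m') n = tens m n + tens m' n.
Proof. exact: pureDl. Qed.
Lemma tensDr m n n' : tens m (n + n') = tens m n + tens m n'.
Proof. exact: pureDr. Qed.
Lemma tens_bal m a n : tens (ract m a) n = tens m (a *: n).
Proof. exact: pure_bal. Qed.
Lemma tensZ a m n : a *: tens m n = tens (a *: m) n.
Proof. exact: tensorA_scaleE. Qed.

Lemma tensorA_ind (P : tensorA -> Prop) :
  P 0 -> (forall u v, P u -> P v -> P (u + v)) ->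
  (forall m n, P (tens m n)) -> forall u, P u.
Proof. exact: tensor_ind. Qed.

End TensorLeft.

Context (M : bimodule).

(* The tensor powers of M over A; the first one is the bimodule M \otimes_A A,
   which is M up to the canonical isomorphism. *)
Fixpoint tpow (n : nat) : lmodType A :=
  if n is n'.+1 then tensorA M (tpow n') else A^o.

Definition tensor_alg := dsum tpow.
HB.instance Definition _ := GRing.Zmodule.on tensor_alg.
Local Notation T := tensor_alg.

Definition tinj n (x : tpow n) : T := dinj x.

Lemma tinjD n : {morph @tinj n : x y / x + y}. Proof. exact: dinjD. Qed.

Lemma tinjE n (x : tpow n) : tinj x n = x. Proof. exact: dinjE. Qed.

(* t is homogeneous of degree n. *)
Definition homog (n : nat) (t : T) := forall i, i != n -> t i = 0.

Lemma tinj_homog n (x : tpow n) : homog n (tinj x).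
Proof. by move=> i; apply: dinj_out. Qed.

Lemma homogP n t : homog n t -> t = tinj (t n).
Proof.
move=> ht; apply: dsumP => i; have [->|ni] := eqVneq i n; first by rewrite dinjE.
by rewrite ht // dinj_out.
Qed.

Lemma homog0 n : homog n 0. Proof. by []. Qed.
Lemma homogD n s t : homog n s -> homog n t -> homog n (s + t).
Proof. by move=> hs ht i ni; rewrite dsumD hs ?ht ?addr0. Qed.

Lemma aact_finite a (t : T) : `[< finitely_supported (fun n => a *: t n) >].
Proof.
by apply/asboolP; have [N tN] := dsum_supp t; exists N => n /tN ->; rewrite scaler0.
Qed.
Definition aact a t : T := DSum (aact_finite a t).

Definition shift_fun (m : M) (t : T) n : tpow n :=
  match n return tpow n with 0 => 0 | n'.+1 => tens m (t n') end.

Lemma shift_finite m t : `[< finitely_supported (shift_fun m t) >].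
Proof.
apply/asboolP; have [N tN] := dsum_supp t; exists N.+1 => [[|n]] //= /tN ->.
exact: (morphD0 (f := tens m) (@tensDr _ _ m)).
Qed.
Definition shift m t : T := DSum (shift_finite m t).

(* Left multiplication by an element of the n-th tensor power: the product of
   m \otimes x and t is m \otimes (x t). *)
Fixpoint lmul n : tpow n -> T -> T :=
  match n return tpow n -> T -> T with
  | 0 => aact
  | n'.+1 => fun u t => tlift (fun m x => shift m (@lmul n' x t)) u
  end.

Definition tmul (s t : T) : T := dlift (fun n x => @lmul n x t) s.
Definition tone : T := @tinj 0 1.

Lemma aactDr a : {morph aact a : s t / s + t}.
Proof. by move=> s t; apply: dsumP => n; apply: scalerDr. Qed.
Lemma aactDl t : {morph aact^~ t : a b / a + b}.
Proof. by move=> a b; apply: dsumP => n; apply: scalerDl. Qed.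
Lemma aactA a b t : aact a (aact b t) = aact (a * b) t.
Proof. by apply: dsumP => n; apply: scalerA. Qed.
Lemma aact1 t : aact 1 t = t.
Proof. by apply: dsumP => n; apply: scale1r. Qed.
Lemma aact_homog n a t : homog n t -> homog n (aact a t).
Proof. by move=> ht i /ht ti; rewrite /= ti scaler0. Qed.

Lemma shiftDr m : {morph shift m : s t / s + t}.
Proof.
by move=> s t; apply: dsumP => -[|n]; rewrite dsumD /= ?addr0 -?tensDr.
Qed.
Lemma shiftDl t : {morph shift^~ t : m m' / m + m'}.
Proof.
by move=> m m'; apply: dsumP => -[|n]; rewrite dsumD /= ?addr0 -?tensDl.
Qed.
Lemma shift_aact m a t : shift (ract m a) t = shift m (aact a t).
Proof. by apply: dsumP => -[|n] //=; rewrite tens_bal. Qed.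
Lemma aact_shift a m t : aact a (shift m t) = shift (a *: m) t.
Proof. by apply: dsumP => -[|n] /=; rewrite ?scaler0 ?tensZ. Qed.
Lemma shift_homog n m t : homog n t -> homog n.+1 (shift m t).
Proof.
move=> ht [|i] //=; rewrite eqSS => /ht ->.
exact: (morphD0 (f := tens m) (@tensDr _ _ m)).
Qed.
Lemma shiftS m t n : shift m t n.+1 = tens m (t n). Proof. by []. Qed.
Lemma shift_tinj m n (x : tpow n) :
  shift m (tinj x) = @tinj n.+1 (tens m x).
Proof.
apply: dsumP => -[|i]; first by rewrite tinj_homog.
rewrite shiftS; have [->|ni] := eqVneq i n; first by rewrite !tinjE.
by rewrite !tinj_homog // (morphD0 (f := tens m) (@tensDr _ _ m)).
Qed.
Lemma aactE a t n : aact a t n = a *: t n. Proof. by []. Qed.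
Lemma aact_tinj a n (x : tpow n) : aact a (tinj x) = tinj (a *: x).
Proof.
apply: dsumP => i; rewrite aactE; have [->|ni] := eqVneq i n.
  by rewrite !tinjE.
by rewrite !tinj_homog // scaler0.
Qed.

Lemma lmul_spec n t :
  {morph (@lmul n)^~ t : x y / x + y} /\
  (forall a x, @lmul n (a *: x) t = aact a (lmul x t)).
Proof.
elim: n => [|n [IHD IHZ]].
  by split=> [|a x]; [apply: aactDl | rewrite /= aactA].
have bal : balanced (@ract M) (@GRing.scale A (tpow n))
    (fun m x => shift m (lmul x t)).
  split=> [m m' x|m x x'|m c x]; first exact: shiftDl.
  - by rewrite IHD shiftDr.
  - by rewrite IHZ shift_aact.
have lD : {morph (@lmul n.+1)^~ t : x y / x + y} by apply: (tliftD bal).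
split=> // a; elim/tensorA_ind=> [|u v IHu IHv|m x].
- by rewrite scaler0 !(morphD0 lD) (morphD0 (@aactDr a)).
- by rewrite scalerDr !lD IHu IHv aactDr.
- by rewrite tensZ /= !(tliftE bal) aact_shift.
Qed.

Lemma lmul_bal n t : balanced (@ract M) (@GRing.scale A (tpow n))
  (fun m x => shift m (lmul x t)).
Proof.
have [lD lZ] := lmul_spec n t; split=> [m m' x|m x x'|m c x].
- exact: shiftDl.
- by rewrite lD shiftDr.
- by rewrite lZ shift_aact.
Qed.

Lemma lmul_tens n m (x : tpow n) t :
  @lmul n.+1 (tens m x) t = shift m (lmul x t).
Proof. exact: (tliftE (lmul_bal n t)). Qed.

Lemma lmulDl n t : {morph (@lmul n)^~ t : x y / x + y}.
Proof. exact: (lmul_spec n t).1. Qed.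

Lemma lmulZ n a x t : @lmul n (a *: x) t = aact a (lmul x t).
Proof. exact: (lmul_spec n t).2. Qed.

Lemma tpow_ind (P : forall n, tpow n -> Prop) :
  (forall n, @P n 0) -> (forall n (u v : tpow n), P n u -> P n v -> P n (u + v)) ->
  (forall a : A, @P 0 a) ->
  (forall n m (x : tpow n), P n x -> @P n.+1 (tens m x)) ->
  forall n (x : tpow n), P n x.
Proof.
move=> P0 PD Pa PS; elim=> [|n IHn]; first exact: Pa.
elim/tensorA_ind=> [||m x]; [exact: (P0 n.+1) | exact: (PD n.+1) | exact: PS].
Qed.

Lemma lmulDr n x : {morph @lmul n x : s t / s + t}.
Proof.
move=> s t; elim/tpow_ind: n / x => [n|n u v IHu IHv|a|n m x IHx].
- by rewrite !(morphD0 (lmulDl _)) addr0.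
- by rewrite !lmulDl IHu IHv addrACA.
- exact: aactDr.
- by rewrite !lmul_tens IHx shiftDr.
Qed.

Lemma lmul_homog m n x t : homog n t -> homog (m + n) (@lmul m x t).
Proof.
move=> ht; elim/tpow_ind: m / x => [k|k u v IHu IHv|a|k m x IHx].
- by rewrite (morphD0 (lmulDl _)).
- by rewrite lmulDl; apply: homogD.
- exact: aact_homog.
- by rewrite lmul_tens; apply: shift_homog.
Qed.

Lemma tmulDl : left_distributive tmul +%R.
Proof. by move=> s s' t; apply: dliftD => n; apply: lmulDl. Qed.

Lemma tmul_tinj n (x : tpow n) t : tmul (tinj x) t = lmul x t.
Proof. by apply: dlift_inj => k; apply: lmulDl. Qed.

Lemma tmulDr : right_distributive tmul +%R.
Proof.
move=> s t u; elim/dsum_ind: s => [|s s' IHs IHs'|n x].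
- by rewrite !(morphD0 (f := tmul^~ _) (fun s s' => tmulDl s s' _)) addr0.
- by rewrite !tmulDl IHs IHs' addrACA.
- by rewrite !tmul_tinj lmulDr.
Qed.

Lemma tmul_aact a s t : tmul (aact a s) t = aact a (tmul s t).
Proof.
elim/dsum_ind: s => [|s s' IHs IHs'|n x].
- rewrite (morphD0 (@aactDr a)).
  rewrite (morphD0 (f := tmul^~ t) (fun s s' => tmulDl s s' t)).
  by rewrite (morphD0 (@aactDr a)).
- by rewrite aactDr !tmulDl IHs IHs' aactDr.
- by rewrite aact_tinj !tmul_tinj lmulZ.
Qed.

Lemma tmul_shift m s t : tmul (shift m s) t = shift m (tmul s t).
Proof.
elim/dsum_ind: s => [|s s' IHs IHs'|n x].
- rewrite (morphD0 (@shiftDr m)).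
  rewrite (morphD0 (f := tmul^~ t) (fun s s' => tmulDl s s' t)).
  by rewrite (morphD0 (@shiftDr m)).
- by rewrite shiftDr !tmulDl IHs IHs' shiftDr.
- by rewrite shift_tinj !tmul_tinj lmul_tens.
Qed.

Lemma tmulA : associative tmul.
Proof.
move=> s t u; elim/dsum_ind: s => [|s s' IHs IHs'|n x].
- by rewrite !(morphD0 (f := tmul^~ _) (fun s s' => tmulDl s s' _)).
- by rewrite !tmulDl IHs IHs'.
rewrite !tmul_tinj; elim/tpow_ind: n / x => [n|n v w IHv IHw|a|n m x IHx].
- rewrite !(morphD0 (lmulDl _)).
  by rewrite (morphD0 (f := tmul^~ u) (fun s s' => tmulDl s s' u)).
- by rewrite !lmulDl tmulDl IHv IHw.
- by rewrite tmul_aact.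
- by rewrite !lmul_tens tmul_shift IHx.
Qed.

Lemma tmul1 : left_id tone tmul.
Proof. by move=> t; rewrite tmul_tinj; apply: aact1. Qed.

Lemma lmul1 n (x : tpow n) : lmul x tone = tinj x.
Proof.
elim/tpow_ind: n / x => [n|n u v IHu IHv|a|n m x IHx].
- by rewrite (morphD0 (lmulDl _)) (morphD0 (@tinjD n)).
- by rewrite lmulDl IHu IHv tinjD.
- by rewrite /= aact_tinj; congr tinj; apply: mulr1.
- by rewrite lmul_tens IHx shift_tinj.
Qed.

Lemma tmulr1 : right_id tone tmul.
Proof.
elim/dsum_ind=> [|s s' IHs IHs'|n x].
- exact: (morphD0 (f := tmul^~ _) (fun s s' => tmulDl s s' _)).
- by rewrite tmulDl IHs IHs'.
- by rewrite tmul_tinj lmul1.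
Qed.

Lemma tone_neq0 : tone != 0.
Proof.
apply/eqP => /(congr1 (fun t : T => t 0%N)); rewrite dinjE.
exact/eqP/(oner_neq0 A).
Qed.

HB.instance Definition _ := GRing.Zmodule_isNzRing.Build T
  tmulA tmul1 tmulr1 tmulDl tmulDr tone_neq0.

Definition talg_scale (k : K) (t : T) : T := aact k%:A t.

Lemma talg_scaleA k l t : talg_scale k (talg_scale l t) = talg_scale (k * l) t.
Proof. by rewrite /talg_scale aactA -scalerAl mul1r scalerA. Qed.
Lemma talg_scale1 : left_id 1 talg_scale.
Proof. by move=> t; rewrite /talg_scale scale1r aact1. Qed.
Lemma talg_scaleDr : right_distributive talg_scale +%R.
Proof. by move=> k; apply: aactDr. Qed.
Lemma talg_scaleDl t : {morph talg_scale^~ t : k l / k + l}.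
Proof. by move=> k l; rewrite /talg_scale scalerDl aactDl. Qed.

HB.instance Definition _ := GRing.Zmodule_isLmodule.Build K T
  talg_scaleA talg_scale1 talg_scaleDr talg_scaleDl.

Lemma talg_scaleAl (k : K) (s t : T) : k *: (s * t) = (k *: s) * t.
Proof. exact/esym/tmul_aact. Qed.
HB.instance Definition _ := GRing.Lmodule_isLalgebra.Build K T talg_scaleAl.

Lemma talg_scaleAr (k : K) (s t : T) : k *: (s * t) = s * (k *: t).
Proof.
elim/dsum_ind: s => [|s s' IHs IHs'|n x].
- by rewrite !mul0r scaler0.
- by rewrite !mulrDl scalerDr IHs IHs'.
rewrite [LHS](congr1 (aact _) (tmul_tinj _ _)) [RHS]tmul_tinj.
elim/tpow_ind: n / x => [n|n u v IHu IHv|a|n m x IHx].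
- by rewrite !(morphD0 (lmulDl _)) (morphD0 (@aactDr _)).
- by rewrite !lmulDl aactDr IHu IHv.
- by rewrite [LHS]aactA [RHS]aactA -scalerAl -scalerAr mul1r mulr1.
- by rewrite !lmul_tens aact_shift lractK shift_aact IHx.
Qed.
HB.instance Definition _ := GRing.Lalgebra_isAlgebra.Build K T talg_scaleAr.

Definition tdeg0 (a : A) : T := @tinj 0 a.
Definition tdeg1 (m : M) : T := shift m 1.

Lemma tdeg0E a t : tdeg0 a * t = aact a t. Proof. exact: tmul_tinj. Qed.
Lemma tdeg1E m t : tdeg1 m * t = shift m t.
Proof. by rewrite [LHS]tmul_shift; congr shift; apply: mul1r. Qed.

Lemma tdeg0D : {morph tdeg0 : a b / a + b}. Proof. exact: (@tinjD 0). Qed.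
Lemma tdeg0_1 : tdeg0 1 = 1. Proof. by []. Qed.
Lemma tdeg0M : {morph tdeg0 : a b / a * b}.
Proof. by move=> a b; rewrite tdeg0E [RHS]aact_tinj. Qed.
Lemma tdeg0Z (k : K) a : tdeg0 (k *: a) = k *: tdeg0 a.
Proof. by rewrite [RHS]aact_tinj [in RHS]/GRing.scale /= -scalerAl mul1r. Qed.
Lemma tdeg0K (k : K) : tdeg0 k%:A = k%:A. Proof. by rewrite tdeg0Z. Qed.
Lemma tdeg0_inj : injective tdeg0.
Proof. by move=> a b /(congr1 (fun t : T => t 0%N)); rewrite !tinjE. Qed.

Lemma tdeg1D : {morph tdeg1 : m m' / m + m'}. Proof. exact: shiftDl. Qed.
Lemma tdeg1_ract m a : tdeg1 (ract m a) = tdeg1 m * tdeg0 a.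
Proof. by rewrite tdeg1E /tdeg1 shift_aact -tdeg0E mulr1. Qed.
Lemma tdeg1Z a m : tdeg1 (a *: m) = tdeg0 a * tdeg1 m.
Proof. by rewrite tdeg0E aact_shift. Qed.
Lemma tdeg1E_tens m n (x : tpow n) :
  tdeg1 m * tinj x = @tinj n.+1 (tens m x).
Proof. by rewrite tdeg1E shift_tinj. Qed.

Lemma homogZ n (k : K) t : homog n t -> homog n (k *: t).
Proof. exact: aact_homog. Qed.
Lemma homogN n t : homog n t -> homog n (- t).
Proof. by move=> ht; rewrite -scaleN1r; apply: homogZ. Qed.
Lemma homogM m n s t : homog m s -> homog n t -> homog (m + n) (s * t).
Proof. by move=> /homogP -> ht; rewrite [_ * _]tmul_tinj; apply: lmul_homog. Qed.
Lemma tdeg0_homog a : homog 0 (tdeg0 a). Proof. exact: tinj_homog. Qed.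
Lemma tdeg1_homog m : homog 1 (tdeg1 m).
Proof. by apply: shift_homog; apply: tdeg0_homog. Qed.
Lemma homog_deg0 t : homog 0 t <-> exists a, t = tdeg0 a.
Proof.
by split=> [/homogP ->|[a ->]]; [exists (t 0%N) | apply: tdeg0_homog].
Qed.

Lemma talg_ind (P : T -> Prop) :
  (forall s t, P s -> P t -> P (s + t)) -> (forall a, P (tdeg0 a)) ->
  (forall m t, P t -> P (tdeg1 m * t)) -> forall t, P t.
Proof.
move=> PD P0 P1; have PZ : P 0 by rewrite -(morphD0 tdeg0D); apply: P0.
elim/dsum_ind=> // n x; elim/tpow_ind: n / x => [n|n u v|a|n m x IHx].
- by rewrite -[dinj _]/(tinj _) (morphD0 (@tinjD n)).
- by rewrite -![dinj _]/(tinj _) tinjD; apply: PD.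
- exact: P0.
- by rewrite -[dinj _]/(tinj _) -tdeg1E_tens; apply: P1.
Qed.

Lemma talg_mul0 (s t : T) : (s * t) 0%N = (s 0%N : A) * (t 0%N : A).
Proof.
elim/talg_ind: s => [s s' IHs IHs'|a|m s IHs].
- by rewrite mulrDl !dsumD IHs IHs' -mulrDl.
- by rewrite tdeg0E tinjE.
- by rewrite -mulrA !tdeg1E mul0r.
Qed.

Definition tcomp n (t : T) : T := tinj (t n).

Lemma tcompD n : {morph tcomp n : s t / s + t}.
Proof. by move=> s t; rewrite /tcomp dsumD tinjD. Qed.
Lemma tcomp_homog n t : homog n (tcomp n t). Proof. exact: tinj_homog. Qed.
Lemma tcomp_id n t : homog n t -> tcomp n t = t. Proof. by move/homogP. Qed.
Lemma tcomp_out m n t : homog n t -> m != n -> tcomp m t = 0.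
Proof. by move=> ht mn; rewrite /tcomp ht // (morphD0 (@tinjD m)). Qed.
Lemma tcompZ n (k : K) t : tcomp n (k *: t) = k *: tcomp n t.
Proof. by rewrite /tcomp [RHS]aact_tinj. Qed.
Lemma tcomp_sum t : exists N, t = \sum_(i < N) tcomp i t.
Proof. by have [N /dsum_decomp] := dsum_supp t; exists N. Qed.

End TensorAlgebra.

Record two_sided_ideal (R : nzRingType) (I : R -> Prop) : Prop := {
  tsi_zero : I 0;
  tsi_add : forall x y, I x -> I y -> I (x + y);
  tsi_mull : forall a x, I x -> I (a * x);
  tsi_mulr : forall x a, I x -> I (x * a)
}.

Definition ideal_gen (R : nzRingType) (S : R -> Prop) (x : R) :=
  forall I : R -> Prop, two_sided_ideal I -> (forall y, S y -> I y) -> I x.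

Section IdealGen.
Context (R : nzRingType) (S : R -> Prop).

Lemma ideal_genP : two_sided_ideal (ideal_gen S).
Proof.
split=> [J Ji SJ|x y Ix Iy J Ji SJ|a x Ix J Ji SJ|x a Ix J Ji SJ].
- exact: tsi_zero Ji.
- by apply: (tsi_add Ji); [apply: Ix | apply: Iy].
- by apply: (tsi_mull Ji); apply: Ix.
- by apply: (tsi_mulr Ji); apply: Ix.
Qed.

Lemma ideal_gen_sub x : S x -> ideal_gen S x.
Proof. by move=> Sx J _; apply. Qed.

End IdealGen.

Record sub_bimodule (K : fieldType) (A : algType K) (M : bimodule A)
    (P : M -> Prop) : Prop := {
  sbm_zero : P 0;
  sbm_add : forall m m', P m -> P m' -> P (m + m');
  sbm_lact : forall a m, P m -> P (a *: m);
  sbm_ract : forall m a, P m -> P (ract m a)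
}.

Definition sub_bimodule_gen (K : fieldType) (A : algType K) (M : bimodule A)
    (S : M -> Prop) (m : M) :=
  forall P : M -> Prop, sub_bimodule P -> (forall w, S w -> P w) -> P m.

Section QuotientAlgebra.
Context (K : fieldType) (R : algType K).

Record proper_two_sided_ideal := ProperIdeal {
  ideal_set :> R -> Prop;
  ideal_tsi : two_sided_ideal ideal_set;
  ideal_proper : ~ ideal_set 1
}.

Context (I : proper_two_sided_ideal).

Definition ideal_pred : {pred R} := fun x => `[< I x >].

Lemma ideal_predP x : reflect (I x) (x \in ideal_pred).
Proof. exact: asboolP. Qed.

Lemma idealN x : I x -> I (- x).
Proof. by rewrite -mulN1r; apply: (tsi_mull (ideal_tsi I)). Qed.
Lemma idealZ (k : K) x : I x -> I (k *: x).
Proof. by rewrite -[x in k *: x]mul1r scalerAl; apply: (tsi_mull (ideal_tsi I)). Qed.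

Lemma ideal_pred_zmod : zmod_closed ideal_pred.
Proof.
split=> [|x y /ideal_predP Ix /ideal_predP Iy]; apply/ideal_predP.
  exact: (tsi_zero (ideal_tsi I)).
by apply: (tsi_add (ideal_tsi I)) => //; apply: idealN.
Qed.
HB.instance Definition _ := GRing.isZmodClosed.Build R ideal_pred ideal_pred_zmod.

Definition quot_alg := {ideal_quot ideal_pred}.
HB.instance Definition _ := GRing.Zmodule.on quot_alg.
Local Notation Q := quot_alg.

Definition qproj (x : R) : Q := \pi x.

Lemma qprojP x y : qproj x = qproj y <-> I (x - y).
Proof.
split=> [/eqP|/ideal_predP Ixy]; last by apply/eqP; rewrite -Quotient.idealrBE.
by rewrite -Quotient.idealrBE => /ideal_predP.
Qed.
Lemma qproj_repr u : qproj (repr u) = u. Proof. exact: reprK. Qed.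
Lemma qproj_surj u : exists x, u = qproj x.
Proof. by exists (repr u); rewrite qproj_repr. Qed.
Lemma repr_qproj x : I (repr (qproj x) - x).
Proof. by apply/qprojP; rewrite qproj_repr. Qed.
Lemma qprojD : {morph qproj : x y / x + y}. Proof. exact: raddfD. Qed.
Lemma qproj0 x : qproj x = 0 <-> I x.
Proof. by rewrite -(morphD0 qprojD) qprojP subr0. Qed.

Definition qmul (u v : Q) : Q := qproj (repr u * repr v).

Lemma qmulE x y : qmul (qproj x) (qproj y) = qproj (x * y).
Proof.
apply/qprojP; set x' := repr _; set y' := repr _.
have -> : x' * y' - x * y = (x' - x) * y' + x * (y' - y).
  by rewrite mulrBl mulrBr addrA subrK.
apply: (tsi_add (ideal_tsi I)).
  by apply: (tsi_mulr (ideal_tsi I)); apply: repr_qproj.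
by apply: (tsi_mull (ideal_tsi I)); apply: repr_qproj.
Qed.

Lemma qmulA : associative qmul.
Proof.
move=> u v w; have [x ->] := qproj_surj u; have [y ->] := qproj_surj v.
have [z ->] := qproj_surj w.
by rewrite (qmulE y z) (qmulE x y) (qmulE x) (qmulE (x * y)) mulrA.
Qed.
Lemma qmul1 : left_id (qproj 1) qmul.
Proof. by move=> u; have [x ->] := qproj_surj u; rewrite qmulE mul1r. Qed.
Lemma qmulr1 : right_id (qproj 1) qmul.
Proof. by move=> u; have [x ->] := qproj_surj u; rewrite qmulE mulr1. Qed.
Lemma qmulDl : left_distributive qmul +%R.
Proof.
move=> u v w; have [x ->] := qproj_surj u; have [y ->] := qproj_surj v.
have [z ->] := qproj_surj w.
by rewrite (qmulE x z) (qmulE y z) -!qprojD (qmulE (x + y)) mulrDl.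
Qed.
Lemma qmulDr : right_distributive qmul +%R.
Proof.
move=> u v w; have [x ->] := qproj_surj u; have [y ->] := qproj_surj v.
have [z ->] := qproj_surj w.
by rewrite (qmulE x y) (qmulE x z) -!qprojD (qmulE x (y + z)) mulrDr.
Qed.
Lemma qone_neq0 : qproj 1 != 0.
Proof. by apply/eqP => /qproj0; apply: ideal_proper. Qed.

HB.instance Definition _ := GRing.Zmodule_isNzRing.Build Q
  qmulA qmul1 qmulr1 qmulDl qmulDr qone_neq0.

Lemma qprojM : {morph qproj : x y / x * y}.
Proof. by move=> x y; rewrite -qmulE. Qed.
Lemma qproj1 : qproj 1 = 1. Proof. by []. Qed.

Definition qscale (k : K) (u : Q) : Q := qproj (k *: repr u).

Lemma qscaleE k x : qscale k (qproj x) = qproj (k *: x).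
Proof. by apply/qprojP; rewrite -scalerBr; apply/idealZ/repr_qproj. Qed.

Lemma qscaleA k l u : qscale k (qscale l u) = qscale (k * l) u.
Proof. by have [x ->] := qproj_surj u; rewrite (qscaleE l) !qscaleE scalerA. Qed.
Lemma qscale1 : left_id 1 qscale.
Proof. by move=> u; have [x ->] := qproj_surj u; rewrite qscaleE scale1r. Qed.
Lemma qscaleDr : right_distributive qscale +%R.
Proof.
move=> k u v; have [x ->] := qproj_surj u; have [y ->] := qproj_surj v.
by rewrite -qprojD !qscaleE -qprojD scalerDr.
Qed.
Lemma qscaleDl u : {morph qscale^~ u : k l / k + l}.
Proof.
by move=> k l; have [x ->] := qproj_surj u; rewrite !qscaleE -qprojD scalerDl.
Qed.
HB.instance Definition _ := GRing.Zmodule_isLmodule.Build K Q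
  qscaleA qscale1 qscaleDr qscaleDl.

Lemma qprojZ (k : K) x : qproj (k *: x) = k *: qproj x.
Proof. by rewrite -qscaleE. Qed.

Lemma qscaleAl (k : K) (u v : Q) : k *: (u * v) = (k *: u) * v.
Proof.
have [x ->] := qproj_surj u; have [y ->] := qproj_surj v.
by rewrite -qprojM -!qprojZ -qprojM scalerAl.
Qed.
HB.instance Definition _ := GRing.Lmodule_isLalgebra.Build K Q qscaleAl.
Lemma qscaleAr (k : K) (u v : Q) : k *: (u * v) = u * (k *: v).
Proof.
have [x ->] := qproj_surj u; have [y ->] := qproj_surj v.
by rewrite -qprojM -!qprojZ -qprojM scalerAr.
Qed.
HB.instance Definition _ := GRing.Lalgebra_isAlgebra.Build K Q qscaleAr.

Lemma qproj_linear : linear qproj.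
Proof. by move=> k x y; rewrite qprojD qprojZ. Qed.
Lemma qproj_monoid : monoid_morphism qproj.
Proof. by split; [apply: qproj1 | apply: qprojM]. Qed.

End QuotientAlgebra.
Section UniversalCalculus.
Context (K : fieldType) (A : algType K).

(* A \otimes_K A, with its outer bimodule structure over A. *)
Definition AA := tensor (fun (x : A) (k : K) => k *: x)
                        (fun (k : K) (y : A) => k *: y).
HB.instance Definition _ := GRing.Zmodule.on AA.

Definition ox (x y : A) : AA := pure x y.

Lemma oxDl x x' y : ox (x + x') y = ox x y + ox x' y. Proof. exact: pureDl. Qed.
Lemma oxDr x y y' : ox x (y + y') = ox x y + ox x y'. Proof. exact: pureDr. Qed.
Lemma ox_bal (k : K) x y : ox (k *: x) y = ox x (k *: y).
Proof. exact: pure_bal. Qed.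

Lemma AA_ind (P : AA -> Prop) :
  P 0 -> (forall u v, P u -> P v -> P (u + v)) ->
  (forall x y, P (ox x y)) -> forall u, P u.
Proof. exact: tensor_ind. Qed.

Lemma AA_ext (V : zmodType) (f g : AA -> V) :
  {morph f : u v / u + v} -> {morph g : u v / u + v} ->
  (forall x y, f (ox x y) = g (ox x y)) -> f =1 g.
Proof.
move=> fD gD fg; elim/AA_ind=> [|u v fu fv|x y]; last exact: fg.
  by rewrite (morphD0 fD) (morphD0 gD).
by rewrite fD gD fu fv.
Qed.

Definition AA_lact (a : A) : AA -> AA := tlift (fun x y => ox (a * x) y).
Definition AA_ract (u : AA) (a : A) : AA := tlift (fun x y => ox x (y * a)) u.
Definition AA_mul : AA -> A := tlift (fun x y => x * y).

Lemma AA_lact_bal a : balanced (fun (x : A) (k : K) => k *: x)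
  (fun (k : K) (y : A) => k *: y) (fun x y => ox (a * x) y).
Proof.
split=> [x x' y|x y y'|x k y]; first by rewrite mulrDr oxDl.
- exact: oxDr.
- by rewrite -scalerAr ox_bal.
Qed.
Lemma AA_ract_bal a : balanced (fun (x : A) (k : K) => k *: x)
  (fun (k : K) (y : A) => k *: y) (fun x y => ox x (y * a)).
Proof.
split=> [x x' y|x y y'|x k y]; first exact: oxDl.
- by rewrite mulrDl oxDr.
- by rewrite -scalerAl ox_bal.
Qed.
Lemma AA_mul_bal : balanced (fun (x : A) (k : K) => k *: x)
  (fun (k : K) (y : A) => k *: y) (fun x y : A => x * y).
Proof.
split=> [x x' y|x y y'|x k y]; first exact: mulrDl.
- exact: mulrDr.
- by rewrite -scalerAl scalerAr.
Qed.

Lemma AA_lactE a x y : AA_lact a (ox x y) = ox (a * x) y.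
Proof. exact: (tliftE (AA_lact_bal a)). Qed.
Lemma AA_ractE a x y : AA_ract (ox x y) a = ox x (y * a).
Proof. exact: (tliftE (AA_ract_bal a)). Qed.
Lemma AA_mulE x y : AA_mul (ox x y) = x * y.
Proof. exact: (tliftE AA_mul_bal). Qed.

Lemma AA_lactDr : right_distributive AA_lact +%R.
Proof. by move=> a; apply: (tliftD (AA_lact_bal a)). Qed.
Lemma AA_ractDl a : {morph AA_ract^~ a : u v / u + v}.
Proof. exact: (tliftD (AA_ract_bal a)). Qed.
Lemma AA_mulD : {morph AA_mul : u v / u + v}.
Proof. exact: (tliftD AA_mul_bal). Qed.

Lemma AA_lactA a b u : AA_lact a (AA_lact b u) = AA_lact (a * b) u.
Proof.
elim/AA_ind: u => [|u v IHu IHv|x y].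
- by rewrite !(morphD0 (AA_lactDr _)).
- by rewrite !AA_lactDr IHu IHv.
- by rewrite !AA_lactE mulrA.
Qed.
Lemma AA_lact1 : left_id 1 AA_lact.
Proof.
apply: AA_ext => [u v|u v|x y] //; [exact: AA_lactDr | by rewrite AA_lactE mul1r].
Qed.
Lemma AA_lactDl u : {morph AA_lact^~ u : a b / a + b}.
Proof.
move=> a b /=; elim/AA_ind: u => [|u v IHu IHv|x y].
- by rewrite !(morphD0 (AA_lactDr _)) addr0.
- by rewrite !AA_lactDr IHu IHv addrACA.
- by rewrite !AA_lactE mulrDl oxDl.
Qed.

HB.instance Definition _ := GRing.Zmodule_isLmodule.Build A AA
  AA_lactA AA_lact1 AA_lactDr AA_lactDl.

Lemma oxZ a x y : a *: ox x y = ox (a * x) y. Proof. exact: AA_lactE. Qed.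

Lemma AA_ractDr u a b : AA_ract u (a + b) = AA_ract u a + AA_ract u b.
Proof.
elim/AA_ind: u => [|u v IHu IHv|x y].
- by rewrite !(morphD0 (AA_ractDl _)) addr0.
- by rewrite !AA_ractDl IHu IHv addrACA.
- by rewrite !AA_ractE mulrDr oxDr.
Qed.
Lemma AA_ractM u a b : AA_ract u (a * b) = AA_ract (AA_ract u a) b.
Proof.
elim/AA_ind: u => [|u v IHu IHv|x y].
- by rewrite !(morphD0 (AA_ractDl _)).
- by rewrite !AA_ractDl IHu IHv.
- by rewrite !AA_ractE mulrA.
Qed.
Lemma AA_ract1 u : AA_ract u 1 = u.
Proof.
elim/AA_ind: u => [|u v IHu IHv|x y].
- by rewrite (morphD0 (AA_ractDl _)).
- by rewrite AA_ractDl IHu IHv.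
- by rewrite AA_ractE mulr1.
Qed.
Lemma AA_lractA a u b : AA_ract (a *: u) b = a *: AA_ract u b.
Proof.
elim/AA_ind: u => [|u v IHu IHv|x y].
- by rewrite scaler0 !(morphD0 (AA_ractDl _)) scaler0.
- by rewrite scalerDr !AA_ractDl IHu IHv scalerDr.
- by rewrite oxZ !AA_ractE oxZ.
Qed.
Lemma AA_lractK (k : K) u : k%:A *: u = AA_ract u k%:A.
Proof.
elim/AA_ind: u => [|u v IHu IHv|x y].
- by rewrite scaler0 (morphD0 (AA_ractDl _)).
- by rewrite scalerDr AA_ractDl IHu IHv.
- by rewrite oxZ AA_ractE -scalerAl mul1r -scalerAr mulr1 ox_bal.
Qed.

Lemma AA_mulZ a u : AA_mul (a *: u) = a * AA_mul u.
Proof.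
elim/AA_ind: u => [|u v IHu IHv|x y].
- by rewrite scaler0 (morphD0 AA_mulD) mulr0.
- by rewrite scalerDr !AA_mulD IHu IHv mulrDr.
- by rewrite oxZ !AA_mulE mulrA.
Qed.
Lemma AA_mul_ract u a : AA_mul (AA_ract u a) = AA_mul u * a.
Proof.
elim/AA_ind: u => [|u v IHu IHv|x y].
- by rewrite (morphD0 (AA_ractDl _)) (morphD0 AA_mulD) mul0r.
- by rewrite AA_ractDl !AA_mulD IHu IHv mulrDl.
- by rewrite AA_ractE !AA_mulE mulrA.
Qed.

Definition ker_mul : {pred AA} := fun u => AA_mul u == 0.

Lemma ker_mulP u : reflect (AA_mul u = 0) (u \in ker_mul).
Proof. exact: eqP. Qed.

Lemma ker_mul_submod : submod_closed ker_mul.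
Proof.
split=> [|a u v /ker_mulP u0 /ker_mulP v0]; apply/ker_mulP.
  exact: (morphD0 AA_mulD).
by rewrite AA_mulD AA_mulZ u0 v0 mulr0 addr0.
Qed.
HB.instance Definition _ := GRing.isSubmodClosed.Build A AA ker_mul ker_mul_submod.

Record omega1 := Omega1 { omega1_val :> AA; omega1P : omega1_val \in ker_mul }.
HB.instance Definition _ := [isSub for omega1_val].
HB.instance Definition _ := [Choice of omega1 by <:].
HB.instance Definition _ := [SubChoice_isSubLmodule of omega1 by <:].

Lemma omega1_ract_subproof (w : omega1) a : AA_ract w a \in ker_mul.
Proof. by apply/ker_mulP; rewrite AA_mul_ract (ker_mulP _ (omega1P w)) mul0r. Qed.
Definition omega1_ract w a : omega1 := Omega1 (omega1_ract_subproof w a).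

Fact omega1_ractDl (w w' : omega1) a :
  omega1_ract (w + w') a = omega1_ract w a + omega1_ract w' a.
Proof. by apply: val_inj; rewrite raddfD; apply: AA_ractDl. Qed.
Fact omega1_ractDr w a b :
  omega1_ract w (a + b) = omega1_ract w a + omega1_ract w b.
Proof. by apply: val_inj; rewrite raddfD; apply: AA_ractDr. Qed.
Fact omega1_ractM w a b :
  omega1_ract w (a * b) = omega1_ract (omega1_ract w a) b.
Proof. by apply: val_inj; apply: AA_ractM. Qed.
Fact omega1_ract1 w : omega1_ract w 1 = w.
Proof. by apply: val_inj; apply: AA_ract1. Qed.
Fact omega1_lractA a w b : omega1_ract (a *: w) b = a *: omega1_ract w b.
Proof. by apply: val_inj; rewrite [RHS]linearZ; apply: AA_lractA. Qed.
Fact omega1_lractK (k : K) w : k%:A *: w = omega1_ract w k%:A.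
Proof. by apply: val_inj; rewrite linearZ; apply: AA_lractK. Qed.

Definition Omega1_u : bimodule A := Bimodule omega1_ractDl omega1_ractDr
  omega1_ractM omega1_ract1 omega1_lractA omega1_lractK.

Lemma du_subproof x : ox 1 x - ox x 1 \in ker_mul.
Proof.
by apply/ker_mulP; rewrite (morphDB AA_mulD) !AA_mulE mul1r mulr1 subrr.
Qed.
Definition du (x : A) : Omega1_u := Omega1 (du_subproof x).

Definition om1val (w : Omega1_u) : AA := omega1_val w.
Lemma om1P w w' : om1val w = om1val w' -> w = w'. Proof. exact: val_inj. Qed.
Lemma om1D w w' : om1val (w + w') = om1val w + om1val w'. Proof. by []. Qed.
Lemma om1N w : om1val (- w) = - om1val w. Proof. by []. Qed.
Lemma om1Z a w : om1val (a *: w) = a *: om1val w. Proof. by []. Qed.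
Lemma om10 : om1val 0 = 0. Proof. by []. Qed.
Lemma om1_ract w a : om1val (ract w a) = AA_ract (om1val w) a. Proof. by []. Qed.
Lemma om1_ker w : AA_mul (om1val w) = 0. Proof. exact/ker_mulP/omega1P. Qed.
Lemma om1val_du x : om1val (du x) = ox 1 x - ox x 1. Proof. by []. Qed.

Lemma duD : {morph du : x y / x + y}.
Proof.
by move=> x y; apply: om1P; rewrite om1D !om1val_du oxDl oxDr opprD addrACA.
Qed.
Lemma duZ (k : K) x : du (k *: x) = k%:A *: du x.
Proof.
apply: om1P; rewrite om1Z !om1val_du scalerBr !oxZ mulr1 -!scalerAl !mul1r.
by rewrite !ox_bal.
Qed.
Lemma duM x y : du (x * y) = ract (du x) y + x *: du y.
Proof.
apply: om1P; rewrite om1D om1Z om1_ract !om1val_du scalerBr !oxZ mulr1.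
by rewrite (morphDB (AA_ractDl y)) !AA_ractE !mul1r addrA subrK.
Qed.
Lemma du1 : du 1 = 0.
Proof. by apply: om1P; rewrite om1val_du subrr. Qed.
Lemma duK (k : K) : du k%:A = 0.
Proof. by rewrite duZ du1 scaler0. Qed.

Definition Omega_u_alg := tensor_alg Omega1_u.
HB.instance Definition _ := GRing.Algebra.on Omega_u_alg.
Local Notation T := Omega_u_alg.

Definition emb0 (a : A) : T := tdeg0 Omega1_u a.
Definition emb1 (w : Omega1_u) : T := tdeg1 w.

Lemma emb0E a (t : T) : emb0 a * t = aact a t. Proof. exact: tdeg0E. Qed.
Lemma emb0D : {morph emb0 : a b / a + b}. Proof. exact: tdeg0D. Qed.
Lemma emb0M : {morph emb0 : a b / a * b}. Proof. exact: tdeg0M. Qed.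
Lemma emb01 : emb0 1 = 1. Proof. by []. Qed.
Lemma emb0K (k : K) : emb0 k%:A = k%:A. Proof. exact: tdeg0K. Qed.
Lemma emb1D : {morph emb1 : w w' / w + w'}. Proof. exact: tdeg1D. Qed.
Lemma emb10 : emb1 0 = 0. Proof. exact: (morphD0 emb1D). Qed.
Lemma emb1_ract w a : emb1 (ract w a) = emb1 w * emb0 a.
Proof. exact: tdeg1_ract. Qed.
Lemma emb1Z a w : emb1 (a *: w) = emb0 a * emb1 w. Proof. exact: tdeg1Z. Qed.

Lemma emb0KC (k : K) (t : T) : emb0 k%:A * t = t * emb0 k%:A.
Proof. by rewrite emb0K -scalerAl mul1r -scalerAr mulr1. Qed.

(* d_u on 1-forms: it maps a form x \otimes y, which is x du(y) modulo
   A \otimes 1, to du(x) du(y). *)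
Definition d1 : AA -> T := tlift (fun x y => emb1 (du x) * emb1 (du y)).

Lemma d1_bal : balanced (fun (x : A) (k : K) => k *: x)
  (fun (k : K) (y : A) => k *: y) (fun x y => emb1 (du x) * emb1 (du y)).
Proof.
split=> [x x' y|x y y'|x k y].
- by rewrite duD emb1D mulrDl.
- by rewrite duD emb1D mulrDr.
- by rewrite !duZ !emb1Z emb0KC -mulrA.
Qed.

Lemma d1E x y : d1 (ox x y) = emb1 (du x) * emb1 (du y).
Proof. exact: (tliftE d1_bal). Qed.
Lemma d1D : {morph d1 : u v / u + v}. Proof. exact: (tliftD d1_bal). Qed.

Lemma d1_du x : d1 (om1val (du x)) = 0.
Proof. by rewrite om1val_du (morphDB d1D) !d1E du1 emb10 mul0r mulr0 subrr. Qed.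

Lemma projl_subproof u : u - ox (AA_mul u) 1 \in ker_mul.
Proof.
by apply/ker_mulP; rewrite (morphDB AA_mulD) AA_mulE mulr1 subrr.
Qed.
(* The linear map sending x \otimes y to x du(y). *)
Definition projl u : Omega1_u := Omega1 (projl_subproof u).
Lemma om1val_projl u : om1val (projl u) = u - ox (AA_mul u) 1. Proof. by []. Qed.
Lemma projr_subproof u : ox 1 (AA_mul u) - u \in ker_mul.
Proof.
by apply/ker_mulP; rewrite (morphDB AA_mulD) AA_mulE mul1r subrr.
Qed.
(* The linear map sending x \otimes y to du(x) y. *)
Definition projr u : Omega1_u := Omega1 (projr_subproof u).
Lemma om1val_projr u : om1val (projr u) = ox 1 (AA_mul u) - u. Proof. by []. Qed.

Lemma projlD : {morph projl : u v / u + v}.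
Proof.
move=> u v; apply: om1P; rewrite om1D !om1val_projl AA_mulD oxDl opprD.
exact: addrACA.
Qed.
Lemma projrD : {morph projr : u v / u + v}.
Proof.
move=> u v; apply: om1P; rewrite om1D !om1val_projr AA_mulD oxDr opprD.
exact: addrACA.
Qed.
Lemma projl_ox x y : projl (ox x y) = x *: du y.
Proof.
apply: om1P; rewrite om1Z om1val_projl om1val_du scalerBr !oxZ AA_mulE.
by rewrite mulr1.
Qed.
Lemma projr_ox x y : projr (ox x y) = ract (du x) y.
Proof.
apply: om1P; rewrite om1_ract om1val_projr om1val_du (morphDB (AA_ractDl y)).
by rewrite !AA_ractE mul1r AA_mulE.
Qed.
Lemma projl_id w : projl (om1val w) = w.
Proof.
apply: om1P; rewrite om1val_projl om1_ker.
by rewrite (morphD0 (f := ox^~ 1) (fun x x' => oxDl x x' 1)) subr0.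
Qed.
Lemma projr_id w : projr (om1val w) = - w.
Proof.
apply: om1P; rewrite om1N om1val_projr om1_ker.
by rewrite (morphD0 (f := ox 1) (oxDr 1)) sub0r.
Qed.

Lemma d1Z_AA a u : d1 (a *: u) = emb1 (du a) * emb1 (projl u) + emb0 a * d1 u.
Proof.
elim/AA_ind: u => [|u v IHu IHv|x y].
- by rewrite scaler0 (morphD0 d1D) (morphD0 projlD) emb10 !mulr0 addr0.
- by rewrite scalerDr !d1D IHu IHv projlD emb1D !mulrDr addrACA.
- rewrite oxZ !d1E projl_ox duM emb1D !emb1Z emb1_ract mulrDl.
  by rewrite !mulrA.
Qed.
Lemma d1_ract_AA a u :
  d1 (AA_ract u a) = d1 u * emb0 a + emb1 (projr u) * emb1 (du a).
Proof.
elim/AA_ind: u => [|u v IHu IHv|x y].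
- by rewrite (morphD0 (AA_ractDl a)) (morphD0 d1D) (morphD0 projrD) emb10 !mul0r
    addr0.
- by rewrite AA_ractDl !d1D IHu IHv projrD emb1D !mulrDl addrACA.
- rewrite AA_ractE !d1E projr_ox duM emb1D !emb1Z !emb1_ract mulrDr.
  by rewrite !mulrA.
Qed.

Lemma d1Z a (w : Omega1_u) :
  d1 (om1val (a *: w)) = emb1 (du a) * emb1 w + emb0 a * d1 (om1val w).
Proof. by rewrite om1Z d1Z_AA projl_id. Qed.
Lemma d1_ract (w : Omega1_u) a :
  d1 (om1val (ract w a)) = d1 (om1val w) * emb0 a - emb1 w * emb1 (du a).
Proof. by rewrite om1_ract d1_ract_AA projr_id (morphDN emb1D) mulNr. Qed.

(* The Leibniz rule: d(w \otimes x) = d(w) x - w d(x). *)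
Fixpoint dpow n : tpow Omega1_u n -> T :=
  match n return tpow Omega1_u n -> T with
  | 0 => fun a => emb1 (du a)
  | n'.+1 => tlift (fun (w : Omega1_u) x =>
               d1 (om1val w) * tinj x - emb1 w * @dpow n' x)
  end.

Definition d_u (t : T) : T := dlift dpow t.

Lemma dpow_spec n :
  {morph @dpow n : x y / x + y} /\
  (forall a x, @dpow n (a *: x) = emb1 (du a) * tinj x + emb0 a * dpow x).
Proof.
elim: n => [|n [IHD IHZ]].
  split=> [x y|a x]; first by rewrite /= [in LHS]duD emb1D.
  by rewrite /= [du _]duM emb1D emb1Z emb1_ract.
have bal : balanced (@ract _ _ Omega1_u) (@GRing.scale A (tpow Omega1_u n))
    (fun (w : Omega1_u) x => d1 (om1val w) * tinj x - emb1 w * dpow x).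
  split=> [w w' x|w x x'|w c x].
  - by rewrite om1D d1D emb1D !mulrDl opprD addrACA.
  - by rewrite IHD tinjD !mulrDr opprD addrACA.
  - rewrite IHZ d1_ract emb1_ract mulrBl -aact_tinj -emb0E mulrDr opprD.
    by rewrite !mulrA -!addrA.
have dD : {morph @dpow n.+1 : x y / x + y} by apply: (tliftD bal).
split=> // a; elim/tensorA_ind=> [|u v IHu IHv|w x].
- by rewrite scaler0 !(morphD0 dD) (morphD0 (@tinjD _ _ Omega1_u n.+1)) !mulr0 addr0.
- by rewrite scalerDr !dD IHu IHv (@tinjD _ _ Omega1_u n.+1) !mulrDr addrACA.
- rewrite tensZ /= !(tliftE bal) d1Z -(tdeg1E_tens w (x : tpow Omega1_u n)) emb1Z.
  by rewrite mulrDl mulrBr !mulrA addrA.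
Qed.

Lemma dpowD n : {morph @dpow n : x y / x + y}. Proof. exact: (dpow_spec n).1. Qed.

Lemma dpow_bal n : balanced (@ract _ _ Omega1_u) (@GRing.scale A (tpow Omega1_u n))
    (fun (w : Omega1_u) x => d1 (om1val w) * tinj x - emb1 w * dpow x).
Proof.
have [dD dZ] := dpow_spec n; split=> [w w' x|w x x'|w c x].
- by rewrite om1D d1D emb1D !mulrDl opprD addrACA.
- by rewrite dD tinjD !mulrDr opprD addrACA.
- rewrite dZ d1_ract emb1_ract mulrBl -aact_tinj -emb0E mulrDr opprD.
  by rewrite !mulrA -!addrA.
Qed.

Lemma d_uD : {morph d_u : s t / s + t}. Proof. exact: (dliftD dpowD). Qed.
Lemma d_u_tinj n (x : tpow Omega1_u n) : d_u (tinj x) = dpow x.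
Proof. exact: (dlift_inj dpowD). Qed.
Lemma d_u_emb0 a : d_u (emb0 a) = emb1 (du a). Proof. exact: d_u_tinj. Qed.
Lemma d_u_emb1M w t : d_u (emb1 w * t) = d1 (om1val w) * t - emb1 w * d_u t.
Proof.
elim/dsum_ind: t => [|s t IHs IHt|n x].
- by rewrite mulr0 (morphD0 d_uD) !mulr0 subr0.
- by rewrite mulrDr !d_uD IHs IHt !mulrDr opprD addrACA.
- rewrite [emb1 w * _]tdeg1E_tens d_u_tinj [d_u _]d_u_tinj.
  exact: (tliftE (dpow_bal n)).
Qed.
Lemma d_u1 : d_u 1 = 0. Proof. by rewrite -emb01 d_u_emb0 du1 emb10. Qed.
Lemma d_u_emb1 w : d_u (emb1 w) = d1 (om1val w).
Proof. by rewrite -[emb1 w]mulr1 d_u_emb1M d_u1 !mulr0 subr0 mulr1. Qed.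

Lemma d_u_emb0M a t : d_u (emb0 a * t) = emb1 (du a) * t + emb0 a * d_u t.
Proof.
elim/dsum_ind: t => [|s t IHs IHt|n x].
- by rewrite mulr0 (morphD0 d_uD) !mulr0 addr0.
- by rewrite mulrDr !d_uD IHs IHt !mulrDr addrACA.
- rewrite emb0E aact_tinj d_u_tinj [d_u _]d_u_tinj.
  exact: (dpow_spec n).2.
Qed.

Lemma d_uZ (k : K) t : d_u (k *: t) = k *: d_u t.
Proof.
have KE (s : T) : k *: s = emb0 k%:A * s by rewrite emb0E.
by rewrite !KE d_u_emb0M duK emb10 mul0r add0r.
Qed.

Lemma d_u_linear : linear d_u.
Proof. by move=> k s t; rewrite d_uD d_uZ. Qed.

Lemma d1_homog u : homog 2 (d1 u).
Proof.
elim/AA_ind: u => [|u v hu hv|x y].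
- by rewrite (morphD0 d1D).
- by rewrite d1D; apply: homogD.
- by rewrite d1E; apply: (@homogM _ _ _ 1 1); apply: tdeg1_homog.
Qed.

Lemma d_u_homog n t : homog n t -> homog n.+1 (d_u t).
Proof.
move=> /homogP ->; rewrite d_u_tinj.
elim/tpow_ind: n / (t n) => [n|n u v hu hv|a|n w x hx].
- by rewrite (morphD0 (@dpowD n)).
- by rewrite dpowD; apply: homogD.
- exact: tdeg1_homog.
- rewrite -d_u_tinj -tdeg1E_tens d_u_emb1M d_u_tinj; apply: homogD.
    by apply: (@homogM _ _ _ 2); [apply: d1_homog | apply: tinj_homog].
  by apply: homogN; apply: (@homogM _ _ _ 1); first exact: tdeg1_homog.
Qed.

Lemma d_u_leibniz m s t : homog m s ->
  d_u (s * t) = d_u s * t + (-1) ^+ m * (s * d_u t).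
Proof.
move=> /homogP ->; elim/tpow_ind: m / (s m) => [n|n u v IHu IHv|a|n w x IHx].
- by rewrite (morphD0 (@tinjD _ _ _ n)) !mul0r (morphD0 d_uD) mul0r mulr0 addr0.
- by rewrite tinjD mulrDl !d_uD IHu IHv !mulrDl mulrDr addrACA.
- by rewrite [LHS]d_u_emb0M mul1r -d_u_emb0.
- rewrite -tdeg1E_tens -!mulrA !d_u_emb1M IHx mulrDr opprD mulrBl !mulrA addrA.
  congr (_ + _); rewrite exprS !mulN1r !mulNr; congr (- _).
  by rewrite (commr_sign (tdeg1 w)).
Qed.

Lemma d_u_square t : d_u (d_u t) = 0.
Proof.
have dd1 u : d_u (d1 u) = 0.
  elim/AA_ind: u => [|u v IHu IHv|x y].
  - by rewrite (morphD0 d1D) (morphD0 d_uD).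
  - by rewrite d1D d_uD IHu IHv addr0.
  - by rewrite d1E d_u_emb1M d_u_emb1 !d1_du mul0r mulr0 subr0.
elim/talg_ind: t => [s t IHs IHt|a|w t IHt].
- by rewrite !d_uD IHs IHt addr0.
- by rewrite [d_u (tdeg0 _ _)]d_u_emb0 d_u_emb1 d1_du.
rewrite -/(emb1 w) d_u_emb1M (morphDB d_uD) d_u_emb1M IHt mulr0 subr0.
rewrite (@d_u_leibniz 2) ?dd1 ?mul0r ?add0r; last exact: d1_homog.
by rewrite sqrrN expr1n mul1r subrr.
Qed.

Definition gr_u (n : int) (t : T) : Prop :=
  if n is Posz m then homog m t else t = 0.

Lemma tcomp_homogP n (t : T) : homog n t <-> tcomp n t = t.
Proof. by split=> [/tcomp_id|<-]; last exact: tcomp_homog. Qed.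

Lemma gr_uP : is_grading gr_u.
Proof.
apply: (@nat_grading K T gr_u (@tcomp K A Omega1_u)).
- exact: tcompD.
- exact: tcompZ.
- by move=> m n t mn; apply: tcomp_out mn; apply: tcomp_homog.
- exact: tcomp_sum.
- exact/tcomp_id/tdeg0_homog.
- by move=> m n x y /tcomp_homogP hx /tcomp_homogP hy; apply/tcomp_homogP/homogM.
- by move=> n t; apply/tcomp_id/tcomp_homog.
- exact: tcomp_homogP.
- by [].
Qed.

Lemma gr_u0 n : gr_u n 0. Proof. by case: n. Qed.

Lemma d_uP : is_differential gr_u d_u.
Proof.
split; [exact: d_u_linear | | | exact: d_u_square].
- case=> n t ht; last by rewrite ht (morphD0 d_uD); apply: gr_u0.
  by rewrite -[1]/(Posz 1) -PoszD addn1; apply: d_u_homog.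
- case=> m s t hs; first exact: d_u_leibniz.
  by rewrite hs (morphD0 d_uD) !mul0r (morphD0 d_uD) mulr0 addr0.
Qed.

Definition Omega_u : gda K := Gda gr_uP d_uP.

(* The sub-bimodule [Z(A), Omega^1_u] of Omega^1_u. *)
Definition commutator_Z (w : Omega1_u) : Prop :=
  sub_bimodule_gen
    (fun v => exists z w', in_center z /\ v = z *: w' - ract w' z) w.

Definition I_Z_gens (t : T) : Prop :=
  exists w, commutator_Z w /\ (t = emb1 w \/ t = d_u (emb1 w)).

Definition I_Z : T -> Prop := ideal_gen I_Z_gens.

Lemma I_ZP : two_sided_ideal I_Z. Proof. exact: ideal_genP. Qed.

Lemma I_Z_deg0 t : I_Z t -> t 0%N = 0.
Proof.
move=> It; apply: (It (fun t => t 0%N = 0)) => [|y [w [_ [->|->]]]].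
- split=> [|x y x0 y0|a x x0|x a x0] //.
  + by rewrite dsumD x0 y0 addr0.
  + by rewrite talg_mul0 x0 mulr0.
  + by rewrite talg_mul0 x0 mul0r.
- exact: tdeg1_homog.
- by rewrite d_u_emb1; apply: d1_homog.
Qed.

Lemma I_Z_proper : ~ I_Z 1.
Proof. by move/I_Z_deg0/eqP; rewrite tinjE; apply/negP/(oner_neq0 A). Qed.

Lemma I_Z_sum I (r : seq I) (P : pred I) (F : I -> T) :
  (forall i, P i -> I_Z (F i)) -> I_Z (\sum_(i <- r | P i) F i).
Proof.
move=> IF; elim/big_ind: _ => //; first exact: tsi_zero I_ZP.
exact: tsi_add I_ZP.
Qed.

Lemma I_Z_tcomp_homog m n t : homog m t -> I_Z t -> I_Z (tcomp n t).
Proof.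
move=> ht It; have [->|nm] := eqVneq n m; first by rewrite tcomp_id.
by rewrite (tcomp_out ht nm); apply: tsi_zero I_ZP.
Qed.

Lemma I_Z_graded n t : I_Z t -> I_Z (tcomp n t).
Proof.
move=> It; move: n; apply: (It (fun t => forall n, I_Z (tcomp n t)))
  => [|y [w [cw yw]] n]; last first.
  have Iy : I_Z y by apply: ideal_gen_sub; exists w.
  case: yw Iy => -> Iy; first by apply: I_Z_tcomp_homog Iy; apply: tdeg1_homog.
  by apply: (@I_Z_tcomp_homog 2) => //; rewrite d_u_emb1; apply: d1_homog.
split=> [n|x y Ix Iy n|a x Ix n|x a Ix n].
- by rewrite (morphD0 (@tcompD _ _ _ n)); apply: tsi_zero I_ZP.
- by rewrite tcompD; apply: (tsi_add I_ZP).
- have [N ->] := tcomp_sum x; have [M ->] := tcomp_sum a.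
  rewrite mulr_suml (morphD_sum (@tcompD _ _ _ n)); apply: I_Z_sum => i _.
  rewrite mulr_sumr (morphD_sum (@tcompD _ _ _ n)); apply: I_Z_sum => j _.
  apply: (@I_Z_tcomp_homog (i + j)); last by apply: (tsi_mull I_ZP).
  by apply: homogM; apply: tcomp_homog.
- have [N ->] := tcomp_sum x; have [M ->] := tcomp_sum a.
  rewrite mulr_suml (morphD_sum (@tcompD _ _ _ n)); apply: I_Z_sum => i _.
  rewrite mulr_sumr (morphD_sum (@tcompD _ _ _ n)); apply: I_Z_sum => j _.
  apply: (@I_Z_tcomp_homog (i + j)); last by apply: (tsi_mulr I_ZP).
  by apply: homogM; apply: tcomp_homog.
Qed.

Lemma d_u_tcomp n t : d_u (tcomp n t) = tcomp n.+1 (d_u t).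
Proof.
elim/dsum_ind: t => [|s t IHs IHt|m x].
- by rewrite (morphD0 d_uD) !(morphD0 (@tcompD _ _ _ _)) (morphD0 d_uD).
- by rewrite !(tcompD, d_uD) IHs IHt.
have hx : homog m (tinj x) by apply: tinj_homog.
have [->|nm] := eqVneq n m.
  by rewrite (tcomp_id hx) tcomp_id //; apply: d_u_homog.
rewrite (tcomp_out hx nm) (tcomp_out (d_u_homog hx)) ?eqSS //.
exact: morphD0 d_uD.
Qed.

Lemma I_Z_sign m t : I_Z t -> I_Z ((-1) ^+ m * t).
Proof. exact: (tsi_mull I_ZP). Qed.

Lemma I_Z_d t : I_Z t -> I_Z (d_u t).
Proof.
move=> It; suff [] : I_Z t /\ I_Z (d_u t) by [].
apply: (It (fun t => I_Z t /\ I_Z (d_u t))) => [|y [w [cw yw]]]; last first.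
  split; first by apply: ideal_gen_sub; exists w.
  case: yw => ->; last by rewrite d_u_square; apply: tsi_zero I_ZP.
  by apply: ideal_gen_sub; exists w; split=> //; right.
split=> [|x y [Ix Idx] [Iy Idy]|a x [Ix Idx]|x a [Ix Idx]].
- by rewrite (morphD0 d_uD); split; apply: tsi_zero I_ZP.
- by rewrite d_uD; split; apply: (tsi_add I_ZP).
- split; first exact: (tsi_mull I_ZP).
  have [N ->] := tcomp_sum a; rewrite mulr_suml (morphD_sum d_uD).
  apply: I_Z_sum => i _; rewrite (d_u_leibniz _ (@tcomp_homog _ _ _ i a)).
  by apply: (tsi_add I_ZP); [|apply: I_Z_sign]; apply: (tsi_mull I_ZP).
- split; first exact: (tsi_mulr I_ZP).
  have [N ->] := tcomp_sum x; rewrite mulr_suml (morphD_sum d_uD).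
  apply: I_Z_sum => i _; rewrite (d_u_leibniz _ (@tcomp_homog _ _ _ i x)).
  apply: (tsi_add I_ZP).
    by apply: (tsi_mulr I_ZP); rewrite d_u_tcomp; apply: I_Z_graded.
  by apply: I_Z_sign; apply: (tsi_mulr I_ZP); apply: I_Z_graded.
Qed.

Lemma I_Z_central z t : in_center z -> I_Z (emb0 z * t - t * emb0 z).
Proof.
move=> zC; elim/talg_ind: t => [s t IHs IHt|a|w t IHt].
- by rewrite mulrDr mulrDl opprD addrACA; apply: (tsi_add I_ZP).
- by rewrite -/(emb0 a) -!emb0M zC subrr; apply: tsi_zero I_ZP.
rewrite -/(emb1 w).
have -> : emb0 z * (emb1 w * t) - emb1 w * t * emb0 z
    = emb1 (z *: w - ract w z) * t + emb1 w * (emb0 z * t - t * emb0 z).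
  rewrite (morphDB emb1D) emb1Z emb1_ract mulrBl mulrBr !mulrA addrA.
  by rewrite subrK.
apply: (tsi_add I_ZP); last exact: (tsi_mull I_ZP).
apply: (tsi_mulr I_ZP); apply: ideal_gen_sub; exists (z *: w - ract w z).
by split; [move=> P _; apply; exists z, w | left].
Qed.

Definition I_Z_ideal : proper_two_sided_ideal T := ProperIdeal I_ZP I_Z_proper.

Definition Omega_Z_alg := quot_alg I_Z_ideal.
HB.instance Definition _ := GRing.Algebra.on Omega_Z_alg.

Definition pi_Z (t : T) : Omega_Z_alg := qproj I_Z_ideal t.

Lemma pi_ZD : {morph pi_Z : s t / s + t}. Proof. exact: qprojD. Qed.
Lemma pi_ZM : {morph pi_Z : s t / s * t}. Proof. exact: qprojM. Qed.
Lemma pi_ZZ (k : K) t : pi_Z (k *: t) = k *: pi_Z t. Proof. exact: qprojZ. Qed.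
Lemma pi_ZP s t : pi_Z s = pi_Z t <-> I_Z (s - t).
Proof. exact: (qprojP I_Z_ideal). Qed.
Lemma pi_Z0 t : pi_Z t = 0 <-> I_Z t. Proof. exact: (qproj0 I_Z_ideal). Qed.
Lemma pi_Z_surj (u : Omega_Z_alg) : exists t, u = pi_Z t. Proof. exact: qproj_surj. Qed.
Lemma repr_pi_Z t : I_Z (repr (pi_Z t) - t). Proof. exact: (repr_qproj I_Z_ideal). Qed.

Definition d_Z (u : Omega_Z_alg) : Omega_Z_alg := pi_Z (d_u (repr u)).

Lemma d_ZE t : d_Z (pi_Z t) = pi_Z (d_u t).
Proof. by apply/pi_ZP; rewrite -(morphDB d_uD); apply: I_Z_d; apply: repr_pi_Z. Qed.

Definition comp_Z n (u : Omega_Z_alg) : Omega_Z_alg := pi_Z (tcomp n (repr u)).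

Lemma comp_ZE n t : comp_Z n (pi_Z t) = pi_Z (tcomp n t).
Proof.
by apply/pi_ZP; rewrite -(morphDB (@tcompD _ _ _ n)); apply: I_Z_graded; apply: repr_pi_Z.
Qed.

Definition gr_Z (n : int) (u : Omega_Z_alg) : Prop :=
  if n is Posz m then exists2 t, homog m t & u = pi_Z t else u = 0.

Lemma comp_ZP n u : gr_Z (Posz n) u <-> comp_Z n u = u.
Proof.
split=> [[t ht ->]|]; first by rewrite comp_ZE tcomp_id.
have [t ->] := pi_Z_surj u; rewrite comp_ZE => <-.
by exists (tcomp n t) => //; apply: tcomp_homog.
Qed.

Lemma gr_ZP : is_grading gr_Z.
Proof.
apply: (@nat_grading K Omega_Z_alg gr_Z comp_Z).
- move=> n u v; have [s ->] := pi_Z_surj u; have [t ->] := pi_Z_surj v.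
  by rewrite -pi_ZD !comp_ZE tcompD pi_ZD.
- move=> n k u; have [t ->] := pi_Z_surj u.
  by rewrite -pi_ZZ !comp_ZE tcompZ pi_ZZ.
- move=> m n u mn; have [t ->] := pi_Z_surj u.
  rewrite !comp_ZE (tcomp_out (@tcomp_homog _ _ _ n t) mn).
  exact: (morphD0 pi_ZD).
- move=> u; have [t ->] := pi_Z_surj u; have [N tN] := tcomp_sum t; exists N.
  rewrite {1}tN (morphD_sum pi_ZD); apply: eq_bigr => i _.
  by rewrite comp_ZE.
- by rewrite -[1]/(pi_Z 1) comp_ZE tcomp_id //; apply: tdeg0_homog.
- move=> m n u v /comp_ZP[s hs ->] /comp_ZP[t ht ->]; apply/comp_ZP.
  by exists (s * t); [apply: homogM | rewrite pi_ZM].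
- move=> n u; have [t ->] := pi_Z_surj u.
  by rewrite !comp_ZE (tcomp_id (@tcomp_homog _ _ _ n t)).
- exact: comp_ZP.
- by [].
Qed.

Lemma gr_Z0 n : gr_Z n 0. Proof. exact: gr_zero gr_ZP n. Qed.

Lemma d_ZD : {morph d_Z : u v / u + v}.
Proof.
move=> u v; have [s ->] := pi_Z_surj u; have [t ->] := pi_Z_surj v.
by rewrite -pi_ZD !d_ZE d_uD pi_ZD.
Qed.

Lemma d_ZP : is_differential gr_Z d_Z.
Proof.
split.
- move=> k u v; have [s ->] := pi_Z_surj u; have [t ->] := pi_Z_surj v.
  by rewrite -pi_ZZ -pi_ZD !d_ZE d_u_linear pi_ZD pi_ZZ.
- move=> [n|n] u; last by move=> ->; rewrite (morphD0 d_ZD); apply: gr_Z0.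
  case=> t ht ->; rewrite -[1]/(Posz 1) -PoszD addn1 d_ZE.
  by exists (d_u t); first exact: d_u_homog.
- move=> [m|m] u v; last first.
    by move=> ->; rewrite (morphD0 d_ZD) !mul0r (morphD0 d_ZD) mulr0 addr0.
  case=> s hs ->; have [t ->] := pi_Z_surj v.
  have sgE x : pi_Z ((-1) ^+ m * x) = (-1) ^+ m * pi_Z x.
    rewrite -[in LHS]signr_odd -[in RHS]signr_odd.
    case: odd; last by rewrite !mul1r.
    by rewrite [in LHS]mulN1r [in RHS]mulN1r (morphDN pi_ZD).
  by rewrite -pi_ZM !d_ZE -!pi_ZM (d_u_leibniz _ hs) pi_ZD sgE.
- move=> u; have [t ->] := pi_Z_surj u.
  by rewrite !d_ZE d_u_square (morphD0 pi_ZD).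
Qed.

Definition Omega_Z_gda : gda K := Gda gr_ZP d_ZP.

Definition emb_Z (a : A) : Omega_Z_gda := pi_Z (emb0 a).

Lemma emb_Z_linear : linear emb_Z.
Proof.
by move=> k a b; rewrite /emb_Z emb0D [emb0 (k *: a)]tdeg0Z pi_ZD pi_ZZ.
Qed.
Lemma emb_Z_monoid : monoid_morphism emb_Z.
Proof. by split=> // a b; rewrite /emb_Z emb0M pi_ZM. Qed.
Lemma emb_Z_inj : injective emb_Z.
Proof.
move=> a b /pi_ZP; rewrite -(morphDB emb0D) => /I_Z_deg0.
by rewrite tinjE => /eqP; rewrite subr_eq0 => /eqP.
Qed.
Lemma emb_Z_deg0 (u : Omega_Z_gda) : gr 0 u <-> exists a, u = emb_Z a.
Proof.
split=> [[t /homog_deg0[a ->] ->]|[a ->]]; first by exists a.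
by exists (emb0 a) => //; apply: tdeg0_homog.
Qed.
Lemma Omega_Z_nneg (n : int) (u : Omega_Z_gda) : n < 0 -> gr n u -> u = 0.
Proof. by case: n => n // _ u0; apply: u0. Qed.
Lemma Omega_Z_central (n : int) (z : A) (u : Omega_Z_gda) :
  in_center z -> gr n u -> emb_Z z * u = u * emb_Z z.
Proof.
move=> zC _; have [t ->] := pi_Z_surj u.
by rewrite -!pi_ZM; apply/pi_ZP; apply: I_Z_central.
Qed.

Definition Omega_Z : calculus A := Calculus emb_Z_linear emb_Z_monoid
  emb_Z_inj emb_Z_deg0 Omega_Z_nneg Omega_Z_central.

End UniversalCalculus.

(* Main.v *)
Require Import Defs.
From mathcomp Require Import all_boot all_order all_algebra.
From mathcomp Require Import boolp.
From mathcomp Require Import reals complex.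

(** A homomorphism [j] that is the identity on [A] has no freedom: a 1-form is a
    sum of terms [x du(y)], which must go to [x d(y)], and 1-forms generate
    [Omega_u] over [A].  Two homomorphisms out of [Omega_Z] that agree on [A] are
    therefore equal ([Omega_Z_hom_ext]).

    Conversely [x \otimes y |-> x d(y)] is defined on all of [A \otimes A].  It is
    left linear, but right linear only up to [xy d(a)], by the Leibniz rule; this
    error vanishes on the kernel of the product, so that the restriction to
    [Omega1_u] is a bimodule map ([form_map_ract]).  The universal property of
    the tensor algebra extends it to an algebra homomorphism [univ_map] from
    [Omega_u] to the given calculus.  This extension commutes with the
    differentials, because both [d_u] and [d] are determined by the Leibniz rule
    and by their values on [A] and on 1-forms, where [x \otimes y] gives
    [d(x) d(y)] on either side ([univ_map_d]).

    Finally the calculus is a central bimodule in degree one, so that [univ_map]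
    vanishes on the commutators [z w - w z]; since it commutes with the
    differentials, it also vanishes on their images under [d_u], hence on the
    ideal [I_Z] ([univ_map_I_Z]), and it descends to [Omega_Z]. *)

Set Implicit Arguments.
Unset Strict Implicit.
Unset Printing Implicit Defensive.

Import GRing.Theory.
Local Open Scope ring_scope.

(** * Linear maps *)

Section LinearMaps.
Context (K : pzRingType) (U V : lmodType K) (f : U -> V) (f_linear : linear f).

Lemma linear_morphD : {morph f : x y / x + y}.
Proof. by move=> x y; rewrite -[x in LHS]scale1r f_linear scale1r. Qed.

Lemma linear_morphZ k x : f (k *: x) = k *: f x.
Proof. by rewrite -[k *: x]addr0 f_linear (morphD0 linear_morphD) addr0. Qed.

End LinearMaps.

(** * The universal property of the tensor algebra *)

Section TensorAlgebraHom.
Context (K : fieldType) (A : algType K) (M : bimodule A) (B : algType K).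
Context (f0 : A -> B) (f1 : M -> B).
Hypotheses (f0_linear : linear f0) (f0_monoid : monoid_morphism f0).
Hypothesis f1D : {morph f1 : m m' / m + m'}.
Hypothesis f1Z : forall a m, f1 (a *: m) = f0 a * f1 m.
Hypothesis f1_ract : forall m a, f1 (ract m a) = f1 m * f0 a.

Local Notation T := (tensor_alg M).

Lemma f0_scalar (k : K) : f0 k%:A = k%:A.
Proof. by rewrite (linear_morphZ f0_linear) f0_monoid.1. Qed.

Fixpoint tpow_hom n : tpow M n -> B :=
  match n return tpow M n -> B with
  | 0 => f0
  | n'.+1 => tlift (fun (m : M) x => f1 m * @tpow_hom n' x)
  end.

Definition talg_hom (t : T) : B := dlift tpow_hom t.

Lemma balanced_f1M (N : lmodType A) (g : N -> B) :
  {morph g : x y / x + y} -> (forall a x, g (a *: x) = f0 a * g x) ->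
  balanced (@ract _ _ M) (@GRing.scale A N) (fun m x => f1 m * g x).
Proof.
move=> gD gZ; split=> [m m' x|m x x'|m c x].
- by rewrite f1D mulrDl.
- by rewrite gD mulrDr.
- by rewrite gZ f1_ract mulrA.
Qed.

(** Additivity and left linearity in degree [n] are what makes the definition
    in degree [n.+1] balanced, hence the joint induction. *)
Lemma tpow_hom_spec n :
  {morph @tpow_hom n : x y / x + y} /\
  (forall a x, @tpow_hom n (a *: x) = f0 a * tpow_hom x).
Proof.
elim: n => [|n [IHD IHZ]].
  by split=> [|a x]; [apply: (linear_morphD f0_linear) | apply: f0_monoid.2].
have bal := balanced_f1M IHD IHZ.
have hD : {morph @tpow_hom n.+1 : x y / x + y} by apply: (tliftD bal).
split=> // a; elim/tensorA_ind=> [|u v IHu IHv|m x].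
- by rewrite scaler0 !(morphD0 hD) mulr0.
- by rewrite scalerDr [LHS]hD [@tpow_hom n.+1 (u + v)]hD mulrDr IHu IHv.
- by rewrite tensZ /= !(tliftE bal) f1Z mulrA.
Qed.

Lemma tpow_homD n : {morph @tpow_hom n : x y / x + y}.
Proof. exact: (tpow_hom_spec n).1. Qed.

Lemma tpow_hom_tens n m (x : tpow M n) :
  @tpow_hom n.+1 (tens m x) = f1 m * tpow_hom x.
Proof.
by have [hD hZ] := tpow_hom_spec n; apply: (tliftE (balanced_f1M hD hZ)).
Qed.

Lemma talg_homD : {morph talg_hom : s t / s + t}.
Proof. exact: (dliftD tpow_homD). Qed.

Lemma talg_hom_tinj n (x : tpow M n) : talg_hom (tinj x) = tpow_hom x.
Proof. exact: (dlift_inj tpow_homD). Qed.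

Lemma talg_hom_tdeg0 a : talg_hom (tdeg0 M a) = f0 a.
Proof. exact: talg_hom_tinj. Qed.

Lemma talg_hom_tdeg0M a t : talg_hom (tdeg0 M a * t) = f0 a * talg_hom t.
Proof.
elim/dsum_ind: t => [|s t IHs IHt|n x].
- by rewrite mulr0 (morphD0 talg_homD) mulr0.
- by rewrite mulrDr !talg_homD IHs IHt mulrDr.
- rewrite tdeg0E aact_tinj talg_hom_tinj [talg_hom _]talg_hom_tinj.
  exact: (tpow_hom_spec n).2.
Qed.

Lemma talg_hom_tdeg1M m t : talg_hom (tdeg1 m * t) = f1 m * talg_hom t.
Proof.
elim/dsum_ind: t => [|s t IHs IHt|n x].
- by rewrite mulr0 (morphD0 talg_homD) mulr0.
- by rewrite mulrDr !talg_homD IHs IHt mulrDr.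
- by rewrite [tdeg1 m * _]tdeg1E_tens talg_hom_tinj tpow_hom_tens
    [talg_hom _]talg_hom_tinj.
Qed.

Lemma talg_hom1 : talg_hom 1 = 1.
Proof. by rewrite -tdeg0_1 talg_hom_tdeg0 f0_monoid.1. Qed.

Lemma talg_hom_tdeg1 m : talg_hom (tdeg1 m) = f1 m.
Proof. by rewrite -[tdeg1 m]mulr1 talg_hom_tdeg1M talg_hom1 mulr1. Qed.

Lemma talg_homM : {morph talg_hom : s t / s * t}.
Proof.
move=> s t; elim/talg_ind: s => [s s' IHs IHs'|a|m s IHs].
- by rewrite mulrDl !talg_homD IHs IHs' mulrDl.
- by rewrite talg_hom_tdeg0M talg_hom_tdeg0.
- by rewrite -mulrA !talg_hom_tdeg1M IHs mulrA.
Qed.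

Lemma talg_homZ (k : K) t : talg_hom (k *: t) = k *: talg_hom t.
Proof.
have -> : k *: t = tdeg0 M k%:A * t by rewrite tdeg0E.
by rewrite talg_hom_tdeg0M f0_scalar -scalerAl mul1r.
Qed.

Lemma talg_hom_gr (G : int -> B -> Prop) : is_grading G ->
  (forall a, G 0 (f0 a)) -> (forall m, G 1 (f1 m)) ->
  forall n t, homog n t -> G (Posz n) (talg_hom t).
Proof.
move=> GP G0 G1 n t /homogP ->; rewrite talg_hom_tinj.
elim/tpow_ind: n / (t n) => [n|n u v Gu Gv|a|n m x Gx].
- by rewrite (morphD0 (@tpow_homD n)); apply: (gr_zero GP).
- by rewrite tpow_homD; apply: (gr_add GP).
- exact: G0.
- rewrite tpow_hom_tens -[Posz n.+1]/(Posz (1 + n)) PoszD.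
  exact: (gr_mul GP).
Qed.

End TensorAlgebraHom.

(** * The homomorphism from the universal calculus *)

Section UniversalMap.
Context (K : fieldType) (A : algType K) (Om : calculus A).

Local Notation inj := (calc_inj Om).
Local Notation d := (@diff K Om).
Local Notation T := (Omega_u_alg A).

Lemma calc_injD : {morph inj : a b / a + b}.
Proof. exact: linear_morphD (calc_inj_linear Om). Qed.

Lemma calc_injM : {morph inj : a b / a * b}.
Proof. exact: (calc_inj_monoid Om).2. Qed.

Lemma calc_inj1 : inj 1 = 1.
Proof. exact: (calc_inj_monoid Om).1. Qed.

Lemma calc_injZ (k : K) a : inj (k *: a) = k *: inj a.
Proof. exact: linear_morphZ (calc_inj_linear Om) k a. Qed.

Lemma calc_inj_gr a : gr 0 (inj a).
Proof. by apply/calc_deg0; exists a. Qed.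

Lemma diffD : {morph d : x y / x + y}.
Proof. exact: linear_morphD (diff_linear (diffP Om)). Qed.

Lemma diffZ (k : K) x : d (k *: x) = k *: d x.
Proof. exact: linear_morphZ (diff_linear (diffP Om)) k x. Qed.

Lemma diff_injM a (x : Om) : d (inj a * x) = d (inj a) * x + inj a * d x.
Proof. by rewrite (diff_leibniz (diffP Om) _ (calc_inj_gr a)) mul1r. Qed.

Lemma diff_deg1M (w x : Om) : gr 1 w -> d (w * x) = d w * x - w * d x.
Proof. by move=> w1; rewrite (diff_leibniz (diffP Om) _ w1) mulN1r. Qed.

Lemma diff1 : d 1 = 0.
Proof.
apply: (addrI (d 1)); have := diff_injM 1 1.
by rewrite calc_inj1 !mulr1 mul1r addr0.
Qed.

Lemma diff_inj_gr a : gr 1 (d (inj a)).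
Proof. exact: (diff_degree (diffP Om) (calc_inj_gr a)). Qed.

(** On all of [A \otimes A], and not only on the kernel of the product, the
    identities below can be checked on pure tensors. *)
Definition form_map : AA A -> Om := tlift (fun x y => inj x * d (inj y)).

Lemma form_map_bal : balanced (fun (x : A) (k : K) => k *: x)
  (fun (k : K) (y : A) => k *: y) (fun x y => inj x * d (inj y)).
Proof.
split=> [x x' y|x y y'|x k y].
- by rewrite calc_injD mulrDl.
- by rewrite calc_injD diffD mulrDr.
- by rewrite !calc_injZ diffZ -scalerAl scalerAr.
Qed.

Lemma form_mapE x y : form_map (ox x y) = inj x * d (inj y).
Proof. exact: (tliftE form_map_bal). Qed.

Lemma form_mapD : {morph form_map : u v / u + v}.
Proof. exact: (tliftD form_map_bal). Qed.

Lemma form_mapZ a u : form_map (a *: u) = inj a * form_map u.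
Proof.
elim/AA_ind: u => [|u v IHu IHv|x y].
- by rewrite scaler0 (morphD0 form_mapD) mulr0.
- by rewrite scalerDr !form_mapD IHu IHv mulrDr.
- by rewrite oxZ !form_mapE calc_injM mulrA.
Qed.

(** The error term comes from [x d(y a) = x d(y) a + x y d(a)]. *)
Lemma form_map_ractE u a :
  form_map (AA_ract u a) = form_map u * inj a + inj (AA_mul u) * d (inj a).
Proof.
elim/AA_ind: u => [|u v IHu IHv|x y].
- by rewrite (morphD0 (AA_ractDl a)) (morphD0 form_mapD) (morphD0 (@AA_mulD _ _))
    (morphD0 calc_injD) !mul0r addr0.
- by rewrite AA_ractDl !form_mapD IHu IHv AA_mulD calc_injD !mulrDl addrACA.
- by rewrite AA_ractE !form_mapE AA_mulE !calc_injM diff_injM mulrDr !mulrA.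
Qed.

Lemma form_map_ract (w : Omega1_u A) a :
  form_map (om1val (ract w a)) = form_map (om1val w) * inj a.
Proof.
by rewrite om1_ract form_map_ractE om1_ker (morphD0 calc_injD) mul0r addr0.
Qed.

Lemma form_map_du a : form_map (om1val (du a)) = d (inj a).
Proof.
by rewrite om1val_du (morphDB form_mapD) !form_mapE calc_inj1 diff1 mulr0 subr0
  mul1r.
Qed.

Lemma form_map_gr u : gr 1 (form_map u).
Proof.
elim/AA_ind: u => [|u v IHu IHv|x y].
- by rewrite (morphD0 form_mapD); apply: (gr_zero (grP Om)).
- by rewrite form_mapD; apply: (gr_add (grP Om)).
- by rewrite form_mapE; apply: (gr_mul (grP Om) (calc_inj_gr x) (diff_inj_gr y)).
Qed.

Definition univ_map : T -> Om := talg_hom inj (fun w => form_map (om1val w)).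

Let form_mapD1 : {morph (fun w : Omega1_u A => form_map (om1val w)) :
  w w' / w + w'}.
Proof. by move=> w w'; rewrite om1D form_mapD. Qed.

Let form_mapZ1 a (w : Omega1_u A) :
  form_map (om1val (a *: w)) = inj a * form_map (om1val w).
Proof. by rewrite om1Z form_mapZ. Qed.

Let injL := calc_inj_linear Om.
Let injM := calc_inj_monoid Om.

Lemma univ_mapD : {morph univ_map : s t / s + t}.
Proof. exact: (talg_homD injL injM form_mapD1 form_mapZ1 form_map_ract). Qed.

Lemma univ_mapM : {morph univ_map : s t / s * t}.
Proof. exact: (talg_homM injL injM form_mapD1 form_mapZ1 form_map_ract). Qed.

Lemma univ_mapZ (k : K) t : univ_map (k *: t) = k *: univ_map t.
Proof. exact: (talg_homZ injL injM form_mapD1 form_mapZ1 form_map_ract). Qed.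

Lemma univ_map_emb0 a : univ_map (emb0 a) = inj a.
Proof. exact: (talg_hom_tdeg0 injL injM form_mapD1 form_mapZ1 form_map_ract). Qed.

Lemma univ_map1 : univ_map 1 = 1.
Proof. by rewrite -emb01 univ_map_emb0 calc_inj1. Qed.

Lemma univ_map_emb1 w : univ_map (emb1 w) = form_map (om1val w).
Proof. exact: (talg_hom_tdeg1 injL injM form_mapD1 form_mapZ1 form_map_ract). Qed.

Lemma univ_map_gr n t : homog n t -> gr (Posz n) (univ_map t).
Proof.
apply: (talg_hom_gr injL injM form_mapD1 form_mapZ1 form_map_ract (grP Om)).
  exact: calc_inj_gr.
by move=> w; apply: form_map_gr.
Qed.

Lemma univ_map_d1 u : univ_map (d1 u) = d (form_map u).
Proof.
elim/AA_ind: u => [|u v IHu IHv|x y].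
- rewrite (morphD0 (@d1D _ _)) (morphD0 univ_mapD) (morphD0 form_mapD).
  by rewrite (morphD0 diffD).
- by rewrite d1D univ_mapD form_mapD diffD IHu IHv.
- rewrite d1E univ_mapM !univ_map_emb1 !form_map_du form_mapE diff_injM.
  by rewrite (diff_square (diffP Om)) mulr0 addr0.
Qed.

(** By induction on [t]: since [emb1 w] and its image both have degree one, the
    Leibniz rules for [emb1 w * t] carry the same sign, which leaves only
    [univ_map_d1] to know. *)
Lemma univ_map_d t : univ_map (d_u t) = d (univ_map t).
Proof.
elim/talg_ind: t => [s t IHs IHt|a|w t IHt].
- by rewrite d_uD !univ_mapD diffD IHs IHt.
- by rewrite [d_u _]d_u_emb0 univ_map_emb1 form_map_du univ_map_emb0.
rewrite -/(emb1 w) d_u_emb1M (morphDB univ_mapD) !univ_mapM IHt univ_map_d1.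
by rewrite univ_map_emb1 diff_deg1M //; apply: form_map_gr.
Qed.

(** The commutators die because the 1-forms of the calculus are a central
    bimodule over [A]. *)
Lemma form_map_commutator w : commutator_Z w -> form_map (om1val w) = 0.
Proof.
move=> cw; apply: (cw (fun w => form_map (om1val w) = 0)).
  split=> [|m m' h h'|a m h|m a h].
  - exact: (morphD0 form_mapD1).
  - by rewrite om1D form_mapD h h' addr0.
  - by rewrite form_mapZ1 h mulr0.
  - by rewrite form_map_ract h mul0r.
move=> v [z [w' [zC ->]]].
rewrite (morphDB form_mapD1) form_mapZ1 form_map_ract.
by rewrite (calc_central zC (form_map_gr _)) subrr.
Qed.

Lemma univ_map_I_Z t : I_Z t -> univ_map t = 0.
Proof.
move=> It; apply: (It (fun t => univ_map t = 0)).
  split=> [|x y hx hy|a x hx|x a hx].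
  - exact: (morphD0 univ_mapD).
  - by rewrite univ_mapD hx hy addr0.
  - by rewrite univ_mapM hx mulr0.
  - by rewrite univ_mapM hx mul0r.
move=> y [w [/form_map_commutator w0 [->|->]]]; first by rewrite univ_map_emb1.
by rewrite univ_map_d univ_map_emb1 w0 (morphD0 diffD).
Qed.

Definition Omega_Z_map (u : Omega_Z A) : Om := univ_map (repr u).

Lemma Omega_Z_mapE t : Omega_Z_map (pi_Z t) = univ_map t.
Proof.
apply/eqP; rewrite -subr_eq0 -(morphDB univ_mapD); apply/eqP.
by apply: univ_map_I_Z; apply: repr_pi_Z.
Qed.

Lemma Omega_Z_map_hom : gda_hom Omega_Z_map.
Proof.
split.
- move=> k u v; have [s ->] := pi_Z_surj u; have [t ->] := pi_Z_surj v.
  by rewrite -pi_ZZ -pi_ZD !Omega_Z_mapE univ_mapD univ_mapZ.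
- split; first by rewrite -[1]/(pi_Z 1) Omega_Z_mapE univ_map1.
  move=> u v; have [s ->] := pi_Z_surj u; have [t ->] := pi_Z_surj v.
  by rewrite -pi_ZM !Omega_Z_mapE univ_mapM.
- case=> n u.
    by case=> t ht ->; rewrite Omega_Z_mapE; apply: univ_map_gr.
  by move=> ->; rewrite -(morphD0 (@pi_ZD _ _)) Omega_Z_mapE (morphD0 univ_mapD);
    apply: (gr_zero (grP Om)).
- move=> u; have [t ->] := pi_Z_surj u.
  by rewrite [diff _]d_ZE !Omega_Z_mapE univ_map_d.
Qed.

Lemma Omega_Z_map_inj a : Omega_Z_map (calc_inj (Omega_Z A) a) = inj a.
Proof. by rewrite [LHS]Omega_Z_mapE univ_map_emb0. Qed.

End UniversalMap.

(** * Uniqueness *)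

Section Uniqueness.
Context (K : fieldType) (A : algType K) (Om : gda K).

(** The algebra [Omega_Z] is generated by [A] and by the classes of the 1-forms
    [x du(y)], which are [x d(y)] computed inside [Omega_Z]. *)
Lemma Omega_Z_hom_ext (j j' : Omega_Z A -> Om) : gda_hom j -> gda_hom j' ->
  (forall a, j (calc_inj (Omega_Z A) a) = j' (calc_inj (Omega_Z A) a)) ->
  j =1 j'.
Proof.
move=> jh jh' jA u; have [t ->] := pi_Z_surj u.
have jD := linear_morphD (gda_hom_linear jh); have jD' := linear_morphD (gda_hom_linear jh').
have [_ jM] := gda_hom_monoid jh; have [_ jM'] := gda_hom_monoid jh'.
(* [projl] is onto [Omega1_u] and sends [x \otimes y] to [x du(y)], so that
   1-forms can be treated by induction on tensors, which need not stay in the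
   kernel of the product. *)
have jform (v : AA A) : j (pi_Z (emb1 (projl v))) = j' (pi_Z (emb1 (projl v))).
  elim/AA_ind: v => [|v v' IHv IHv'|x y].
  - by rewrite (morphD0 (@projlD _ _)) emb10 (morphD0 (@pi_ZD _ _)) (morphD0 jD)
      (morphD0 jD').
  - by rewrite projlD emb1D pi_ZD jD jD' IHv IHv'.
  - rewrite projl_ox emb1Z -d_u_emb0 pi_ZM -d_ZE jM jM'.
    by rewrite [j (d_Z _)](gda_hom_diff jh) [j' (d_Z _)](gda_hom_diff jh') !jA.
elim/talg_ind: t => [s t IHs IHt|a|w t IHt].
- by rewrite pi_ZD jD jD' IHs IHt.
- exact: jA.
- by rewrite pi_ZM jM jM' IHt -[w]projl_id jform.
Qed.

End Uniqueness.

Local Open Scope complex_scope.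

Theorem corollary2 (R : realType) (A : algType R[i]) (Omega : calculus A) :
  exists! j : Omega_Z A -> Omega,
    gda_hom j /\
    forall a : A, j (calc_inj (Omega_Z A) a) = calc_inj Omega a.
Proof.
exists (@Omega_Z_map _ A Omega); split=> [|j [jh jA]].
  by split; [apply: Omega_Z_map_hom | apply: Omega_Z_map_inj].
apply/funext/Omega_Z_hom_ext => // [|a]; first exact: Omega_Z_map_hom.
by rewrite Omega_Z_map_inj jA.
Qed.
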